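(* For $p\in[\tfrac12,1]$ let $G_p$ be the two-player repeated game and $\sigma^*=\sigma^*_p$ the strategy for Ian in $G_p$ described in the context. Then $\sigma^*$ is an optimal strategy for Ian in $G_p$ for every $p$ with $\tfrac12\le p<0.719$, and there exists some $p$ with $\tfrac12\le p<0.733$ such that $\sigma^*$ is not an optimal strategy for Ian in $G_p$.
   Context: **The game $G_p$.** Fix $p\in[\frac12,1]$. At stages $n=1,2,\dots$ the system is in a state $s_n\in\{S_0,S_1\}$; $s_1$ is uniformly distributed and, independently of the players' actions, $s_{n+1}=s_n$ with probability $p$ and $s_{n+1}\ne s_n$ with probability $1-p$ (a Markov chain). At each stage Ian (the informed player) is told $s_n$; Una (the uninformed player) is never told the state. They simultaneously choose $i_n\in\{0,1\}$ (Ian) and $u_n\in\{0,1\}$ (Una). Una owes Ian $1$ if either $s_n=S_0$ and $i_n=u_n=0$, or $s_n=S_1$ and $i_n=u_n=1$; otherwise $0$. Both players observe past moves $(i_k,u_k)_{k<n}$, but Una does not observe payoffs. The number $p$ is known to both. A (mixed) strategy for Ian is a map $\sigma:\bigcup_{n\ge0}(\{0,1\}\times\{0,1\}\times\{S_0,S_1\})^n\to[0,1]^2$, whose value $(q_0,q_1)$ at the history of past moves and past states gives the probabilities of playing $1$ if the current state is $S_0$, resp. $S_1$. A strategy for Una is a map $\tau:\bigcup_{n\ge0}(\{0,1\}\times\{0,1\})^n\to[0,1]$ giving the probability of playing $1$ after each history of past moves. $\gamma_N(\sigma,\tau)$ denotes Ian's expected payoff per round over the first $N$ rounds. A number $v$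 is the value of the game if for each $\epsilon>0$ there are $N_0$ and strategies $\sigma',\tau'$ such that for all $N\ge N_0$: $\gamma_N(\sigma',\tau)>v-\epsilon$ for every $\tau$, and $\gamma_N(\sigma,\tau')<v+\epsilon$ for every $\sigma$. (It is known, by Renault, that the value exists.) A strategy $\sigma$ for Ian is optimal if $\liminf_{N\to\infty}\gamma_N(\sigma,\tau)\ge v$ for every strategy $\tau$ of Una, where $v$ is the value. **The strategy $\sigma^*$.** Define for $\theta\in[0,1]$ $$f_0(\theta)=\begin{cases}p\frac{2\theta-1}{\theta}+(1-p)\frac{1-\theta}{\theta}&\theta\ge\frac12\\ 1-p&\theta\le\frac12\end{cases},\qquad f_1(\theta)=\begin{cases}p&\theta\ge\frac12\\ p\frac{\theta}{1-\theta}+(1-p)\frac{1-2\theta}{1-\theta}&\theta\le\frac12.\end{cases}$$ Let $\theta_1=\frac12$ and $\theta_{n+1}=f_{i_n}(\theta_n)$; $\theta_n$ is Una's belief at stage $n$, i.e. the conditional probability that $s_n=S_1$ given the past moves, assuming Ian plays $\sigma^*$. Under $\sigma^*$, at a stage with belief $\theta$, Ian plays $1$ with probability: $1$ if the state is $S_1$ and $\theta\le\frac12$; $\frac{1-2\theta}{1-\theta}$ if the state is $S_0$ and $\theta\le\frac12$; $\frac{1-\theta}{\theta}$ if the state is $S_1$ and $\theta\ge\frac12$; $0$ if the state is $S_0$ and $\theta\ge\frac12$. He plays $0$ with the complementary probability. *)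

(* Defs.v *)
From mathcomp Require Import all_boot all_order all_algebra.
From mathcomp Require Import all_classical all_reals all_analysis.
From mathcomp Require Import lra.

Set Implicit Arguments.
Unset Strict Implicit.
Unset Printing Implicit Defensive.

Import Order.TTheory GRing.Theory Num.Theory.
Local Open Scope ring_scope.

(* A stage is recorded as (Ian's move, Una's move, state).  Moves 0 and 1 are
   [false] and [true]; the states S_0 and S_1 are [false] and [true].
   Histories are listed in chronological order. *)
Definition stage : finType := (bool * bool * bool)%type.

Definition ian_move (x : stage) : bool := x.1.1.
Definition una_move (x : stage) : bool := x.1.2.
Definition stage_state (x : stage) : bool := x.2.

Definition public_history (h : seq stage) : seq (bool * bool) :=
  [seq x.1 | x <- h].

Section Game.
Variable R : realType.

(* The two components are the probabilities of playing 1 when the current state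
   is S_0, resp. S_1. *)
Definition ian_fun := seq stage -> R * R.
Definition una_fun := seq (bool * bool) -> R.

Definition is_ian_strategy (sigma : ian_fun) : Prop :=
  forall h, (0 <= (sigma h).1 <= 1) /\ (0 <= (sigma h).2 <= 1).

Definition is_una_strategy (tau : una_fun) : Prop :=
  forall h, 0 <= tau h <= 1.

Definition bernoulli_weight (q : R) (b : bool) : R := if b then q else 1 - q.

Definition state_weight (p : R) (h : seq stage) (s : bool) : R :=
  if h is x :: h' then
    (if s == stage_state (last x h') then p else 1 - p)
  else 2^-1.

Definition stage_weight (p : R) (sigma : ian_fun) (tau : una_fun)
    (h : seq stage) (x : stage) : R :=
  state_weight p h (stage_state x)
  * bernoulli_weight
      (if stage_state x then (sigma h).2 else (sigma h).1) (ian_move x)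
  * bernoulli_weight (tau (public_history h)) (una_move x).

(* The probability that the first [N] stages are [h]; the stage at index [n]
   is drawn given the history [take n h] that precedes it. *)
Definition play_prob (p : R) (sigma : ian_fun) (tau : una_fun)
    (N : nat) (h : N.-tuple stage) : R :=
  \prod_(n < N) stage_weight p sigma tau (take n h) (tnth h n).

Definition payoff (x : stage) : R :=
  ((ian_move x == stage_state x) && (una_move x == stage_state x))%:R.

Definition gamma (p : R) (N : nat) (sigma : ian_fun) (tau : una_fun) : R :=
  (\sum_(h : N.-tuple stage)
     play_prob p sigma tau h * \sum_(n < N) payoff (tnth h n)) / N%:R.

Definition is_value (p v : R) : Prop :=
  forall eps : R, 0 < eps ->
  exists (N0 : nat) (sigma' : ian_fun) (tau' : una_fun),
    [/\ is_ian_strategy sigma', is_una_strategy tau' &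
     forall N : nat, (N0 <= N)%N ->
       (forall tau, is_una_strategy tau -> v - eps < gamma p N sigma' tau) /\
       (forall sigma, is_ian_strategy sigma -> gamma p N sigma tau' < v + eps)].

(* At most one [v] satisfies [is_value p v], so the existential below denotes
   the value of the game. *)
Definition is_optimal (p : R) (sigma : ian_fun) : Prop :=
  is_ian_strategy sigma /\
  exists v : R, is_value p v /\
    forall tau, is_una_strategy tau ->
      (v%:E <= limn_einf (fun N => (gamma p N sigma tau)%:E))%E.

Definition belief_f0 (p theta : R) : R :=
  if 2^-1 <= theta
  then p * ((2 * theta - 1) / theta) + (1 - p) * ((1 - theta) / theta)
  else 1 - p.

Definition belief_f1 (p theta : R) : R :=
  if 2^-1 <= theta
  then p
  else p * (theta / (1 - theta)) + (1 - p) * ((1 - 2 * theta) / (1 - theta)).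

Definition belief_step (p theta : R) (i : bool) : R :=
  if i then belief_f1 p theta else belief_f0 p theta.

(* Una's belief that the current state is S_1 if Ian follows [sigma_star]; it
   depends on Ian's past moves only. *)
Definition belief (p : R) (h : seq stage) : R :=
  foldl (belief_step p) 2^-1 [seq ian_move x | x <- h].

Definition sigma_star (p : R) : ian_fun := fun h =>
  let theta := belief p h in
  if theta <= 2^-1 then ((1 - 2 * theta) / (1 - theta), 1)
  else (0, (1 - theta) / theta).

Let div01 (x y : R) : 0 <= x -> x <= y -> 0 < y -> 0 <= x / y <= 1.
Proof.
move=> x0 xy y0; rewrite divr_ge0 ?(ltW y0) //=.
by rewrite ler_pdivrMr // mul1r.
Qed.

Let mix01 (p a b : R) :
  0 <= p <= 1 -> 0 <= a <= 1 -> 0 <= b <= 1 -> 0 <= p * a + (1 - p) * b <= 1.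
Proof.
move=> /andP[p0 p1] /andP[a0 a1] /andP[b0 b1]; apply/andP; split; nra.
Qed.

Lemma belief_itv (p : R) (h : seq stage) :
  0 <= p <= 1 -> 0 <= belief p h <= 1.
Proof.
move=> hp; rewrite /belief.
have : 0 <= (2^-1 : R) <= 1 by apply/andP; split; lra.
elim: [seq ian_move x | x <- h] (2^-1 : R) => //= i s IH t /andP[t0 t1].
apply: IH; case: i; rewrite /belief_step /belief_f0 /belief_f1.
  case: (leP (2^-1) t) => // ht.
  by apply: mix01 => //; apply: div01; lra.
case: (leP (2^-1) t) => ht; last by move: hp => /andP[? ?]; apply/andP; split; lra.
by apply: mix01 => //; apply: div01; lra.
Qed.

Lemma sigma_star_is_strategy (p : R) :
  0 <= p <= 1 -> is_ian_strategy (sigma_star p).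
Proof.
move=> hp h; have /andP[t0 t1] := belief_itv h hp; rewrite /sigma_star.
case: (leP (belief p h) 2^-1) => ht /=; split; rewrite ?lexx ?ler01 //.
  by apply: div01; lra.
by apply: div01; lra.
Qed.

End Game.

(* Main.v *)
Require Import Defs.
From Stdlib Require Import ZArith.
From mathcomp Require Import all_boot all_order all_algebra.
From mathcomp Require Import all_classical all_reals all_analysis.
From mathcomp Require Import ring lra zify ssrZ.
Import Order.TTheory GRing.Theory Num.Theory.
Import numFieldNormedType.Exports.
Local Open Scope ring_scope.

Set Implicit Arguments.
Unset Strict Implicit.
Unset Printing Implicit Defensive.

(* Under [sigma_star] the expected payoff of a stage is min(theta, 1 - theta),
   whatever Una does, where theta is the belief; with the same probability Ian's
   move reveals the state and the belief restarts at 1 - p or p.  Folding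
   beliefs to [0, 1/2], this is a Markov chain driven by the maps x -> upd x and
   x -> 1 - upd x.

   Optimality for p < 0.719.  The bias h of this chain is sought in the form
   h(x) = - kappa * sum over kinks y of weight(y) * max(0, y - x), the kinks
   being the iterated preimages of 1/2.  Any finite truncation of this sum
   solves the evaluation equation of [sigma_star] up to the total weight of the
   first omitted generation of kinks.  The tangent lines of the concave function
   h give Una an automaton (the tangent at the current belief determines her
   mixed move) which guarantees the same value up to the same error.  So
   [sigma_star] is optimal as soon as the weight of the n-th generation of kinks
   tends to 0; this weight is computed by a transfer operator, which is shown to
   contract a suitable piecewise constant test function.

   Failure for some p < 0.733.  At belief 1/2, [sigma_star] reveals the state.
   For p = 32734/44667 (about 0.7328453) it is better to play near 1/2 so that
   the posterior is alpha or 1 - alpha with alpha = 1/2500.  Both average payoffs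
   are bounded by potentials obtained by truncating the evaluation at a finite
   horizon, and computed in exact integer arithmetic. *)

(** * Expected payoffs and potentials *)

Section Play.
Variable R : realType.
Variables (p : R) (sigma : ian_fun R) (tau : una_fun R).
Hypothesis p01 : 0 <= p <= 1.
Hypothesis sigmaP : is_ian_strategy sigma.
Hypothesis tauP : is_una_strategy tau.

Definition expect (N : nat) (F : seq stage -> R) : R :=
  \sum_(h : N.-tuple stage) play_prob p sigma tau h * F h.

Definition total_payoff (h : seq stage) : R := \sum_(x <- h) payoff R x.

Local Notation sw := (stage_weight p sigma tau).

Lemma gammaE N : gamma p N sigma tau = expect N total_payoff / N%:R.
Proof.
rewrite /gamma /expect; congr (_ / _); apply: eq_bigr => h _.
by rewrite /total_payoff big_tuple.
Qed.

Lemma play_prob_rcons N (t : N.-tuple stage) (x : stage) :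
  play_prob p sigma tau [tuple of rcons t x] = play_prob p sigma tau t * sw t x.
Proof.
rewrite /play_prob big_ord_recr /=; congr (_ * _).
  apply: eq_bigr => i _; congr (stage_weight _ _ _ _ _).
    by rewrite -cats1 takel_cat // size_tuple ltnW.
  rewrite (tnth_nth x) (tnth_nth x) /= nth_rcons size_tuple ltn_ord.
  by apply: set_nth_default; rewrite size_tuple.
congr (stage_weight _ _ _ _ _).
  by rewrite -cats1 take_size_cat // size_tuple.
by rewrite (tnth_nth x) /= nth_rcons size_tuple ltnn eqxx.
Qed.

Lemma expectS N F :
  expect N.+1 F = expect N (fun h => \sum_x sw h x * F (rcons h x)).
Proof.
rewrite /expect.
pose f (u : N.-tuple stage * stage) := [tuple of rcons u.1 u.2].
have fbij : bijective f.
  apply: inj_card_bij => [[t x] [t' x'] /(congr1 val) /= /rcons_inj[tt' ->]|].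
    by congr pair; apply/val_inj.
  by rewrite card_prod !card_tuple expnSr.
rewrite (reindex f) /=; last exact: onW_bij.
rewrite -(pair_big xpredT xpredT (fun t x => play_prob p sigma tau (f (t, x)) * F (f (t, x)))) /=.
apply: eq_bigr => t _; rewrite mulr_sumr; apply: eq_bigr => x _.
by rewrite /f play_prob_rcons mulrA.
Qed.

Lemma expect0 F : expect 0 F = F [::].
Proof.
rewrite /expect (big_pred1 (nil_tuple stage)) => [|t]; last by rewrite /= (tuple0 t) eqxx.
by rewrite /play_prob big_ord0 mul1r.
Qed.

Lemma sum_stage (F : stage -> R) :
  \sum_x F x = \sum_(s : bool) \sum_(u : bool) \sum_(i : bool) F (i, u, s).
Proof.
rewrite (eq_bigr (fun x : stage => F (x.1, x.2))); last by case.
rewrite -(pair_big xpredT xpredT (fun y s => F (y, s))) /= exchange_big /=.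
apply: eq_bigr => s _.
rewrite (eq_bigr (fun y : bool * bool => F (y.1, y.2, s))); last by case.
by rewrite -(pair_big xpredT xpredT (fun i u => F (i, u, s))) /= exchange_big.
Qed.

Lemma state_weight_ge0 h s : 0 <= state_weight p h s.
Proof.
rewrite /state_weight; case: h => [|x h]; first by rewrite invr_ge0.
by case: ifP => _; move: p01 => /andP[? ?]; lra.
Qed.

Lemma stage_weight_ge0 h x : 0 <= sw h x.
Proof.
rewrite /stage_weight; apply: mulr_ge0; first (apply: mulr_ge0).
- exact: state_weight_ge0.
- have [h1 h2] := sigmaP h; rewrite /bernoulli_weight.
  by case: (stage_state x) (ian_move x) => -[] /=; lra.
- have ht := tauP (public_history h); rewrite /bernoulli_weight.
  by case: (una_move x) => /=; lra.
Qed.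

Lemma state_weightC h : state_weight p h false = 1 - state_weight p h true.
Proof.
rewrite /state_weight; case: h => [|x h]; first lra.
by case: (stage_state _) => /=; lra.
Qed.

Lemma stage_weightE h i u s : sw h (i, u, s) =
  state_weight p h s * bernoulli_weight (if s then (sigma h).2 else (sigma h).1) i
   * bernoulli_weight (tau (public_history h)) u.
Proof. by []. Qed.

Lemma stage_weight_sum h : \sum_x sw h x = 1.
Proof.
rewrite sum_stage !big_bool /= !stage_weightE state_weightC /bernoulli_weight.
by ring.
Qed.

Lemma expect_eq N F G : F =1 G -> expect N F = expect N G.
Proof. by move=> FG; apply: eq_bigr => h _; rewrite FG. Qed.

Lemma play_prob_ge0 N (h : N.-tuple stage) : 0 <= play_prob p sigma tau h.
Proof. by apply: prodr_ge0 => i _; exact: stage_weight_ge0. Qed.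

Lemma expect_le N F G : (forall h, F h <= G h) -> expect N F <= expect N G.
Proof.
by move=> FG; apply: ler_sum => h _; apply: ler_wpM2l; rewrite ?play_prob_ge0.
Qed.

Lemma expectD N F G : expect N (fun h => F h + G h) = expect N F + expect N G.
Proof.
by rewrite /expect -big_split; apply: eq_bigr => h _; rewrite mulrDr.
Qed.

Lemma expectZ N (k : R) F : expect N (fun h => k * F h) = k * expect N F.
Proof.
by rewrite /expect mulr_sumr; apply: eq_bigr => h _; rewrite mulrCA.
Qed.

Lemma expect_cst N (k : R) : expect N (fun=> k) = k.
Proof.
elim: N => [|N IH]; first by rewrite expect0.
rewrite expectS -[RHS]IH; apply: expect_eq => h.
by rewrite -mulr_suml stage_weight_sum mul1r.
Qed.

Lemma total_payoff_rcons h x : total_payoff (rcons h x) = total_payoff h + payoff R x.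
Proof. by rewrite /total_payoff -cats1 big_cat big_seq1. Qed.

Lemma expect_payoffS N (k : R) (Z : seq stage -> R) :
  expect N.+1 (fun h => k * total_payoff h + Z h) =
  expect N (fun h => k * total_payoff h +
     \sum_x sw h x * (k * payoff R x + Z (rcons h x))).
Proof.
rewrite expectS; apply: expect_eq => h.
rewrite -[k * total_payoff h]mul1r -(stage_weight_sum h) mulr_suml -big_split /=.
by apply: eq_bigr => x _; rewrite total_payoff_rcons; ring.
Qed.

(** The one-step inequality telescopes: each stage costs at most [v], and the potential survives
    only at the two ends. *)
Lemma expect_potential_le N (v : R) (Z : seq stage -> R) :
  (forall h, \sum_x sw h x * (payoff R x + Z (rcons h x)) <= v + Z h) ->
  expect N (fun h => total_payoff h + Z h) <= N%:R * v + Z [::].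
Proof.
move=> H; elim: N => [|N IH].
  by rewrite expect0 /total_payoff big_nil mul0r lexx.
have -> : expect N.+1 (fun h => total_payoff h + Z h) =
    expect N.+1 (fun h => 1 * total_payoff h + Z h).
  by apply: expect_eq => h; rewrite mul1r.
rewrite expect_payoffS.
apply: (@le_trans _ _ (expect N (fun h => v + (total_payoff h + Z h)))).
  apply: expect_le => h; rewrite mul1r addrCA lerD2l.
  by under eq_bigr do rewrite mul1r; exact: H.
by rewrite expectD expect_cst -natr1 mulrDl mul1r; move: IH; lra.
Qed.

End Play.

(** * Strategies of Ian driven by the belief *)

Section BeliefStrategy.
Variable R : realType.
Variables (p : R) (act : R -> R * R) (next : R -> bool -> R) (D : R -> Prop).

Definition move_prob (theta : R) (i : bool) : R :=
  (1 - theta) * bernoulli_weight (act theta).1 i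
  + theta * bernoulli_weight (act theta).2 i.

Definition mean_payoff (theta : R) (u : bool) : R :=
  if u then theta * (act theta).2 else (1 - theta) * (1 - (act theta).1).

Definition belief_after (m : seq bool) : R := foldl next 2^-1 m.

Definition belief_strategy : ian_fun R :=
  fun h => act (belief_after [seq ian_move x | x <- h]).

Hypothesis p01 : 0 <= p <= 1.
Hypothesis actP : is_ian_strategy belief_strategy.
Hypothesis D_half : D 2^-1.
Hypothesis D_next : forall theta i, D theta -> D (next theta i).
Hypothesis next_bayes : forall theta i, D theta ->
  move_prob theta i * next theta i =
  (1 - p) * ((1 - theta) * bernoulli_weight (act theta).1 i)
  + p * (theta * bernoulli_weight (act theta).2 i).

Variable tau : una_fun R.
Hypothesis tauP : is_una_strategy tau.

Local Notation EE := (expect p belief_strategy tau).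
Local Notation sw := (stage_weight p belief_strategy tau).
Local Notation bel h := (belief_after [seq ian_move x | x <- h]).

Lemma belief_after_rcons m i : belief_after (rcons m i) = next (belief_after m) i.
Proof. by rewrite /belief_after -cats1 foldl_cat. Qed.

Lemma belief_afterD m : D (belief_after m).
Proof.
elim/last_ind: m => [|m i IH]; first exact: D_half.
by rewrite belief_after_rcons; exact: D_next.
Qed.

Lemma bel_public h : bel h = belief_after (map fst (public_history h)).
Proof. by rewrite /public_history -map_comp. Qed.

Lemma state_weight_rcons h x s :
  state_weight p (rcons h x) s = if s == stage_state x then p else 1 - p.
Proof. by case: h => //= y h; rewrite last_rcons. Qed.

(** This says that [bel h] is the conditional probability of S_1 given the public history, tested
    against an arbitrary public function [f]; letting [f] vary is what makes the induction go
    through. *)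
Lemma expect_belief N (f : seq (bool * bool) -> R) :
  EE N (fun h => f (public_history h) * (state_weight p h true - bel h)) = 0.
Proof.
elim: N f => [|N IH] f; first by rewrite expect0 /= subrr mulr0.
rewrite expectS.
(* [B t s i] is the probability of move [i] in state [s] times the excess of the true chance of S_1
   at the next stage over Una's updated belief. *)
pose B t s i : R := bernoulli_weight (if s then (act t).2 else (act t).1) i *
   ((if s then p else 1 - p) - next t i).
pose f' (m : seq (bool * bool)) : R := let t := belief_after (map fst m) in
  \sum_(u : bool) \sum_(i : bool) bernoulli_weight (tau m) u * f (rcons m (i, u))
     * (B t true i - B t false i).
rewrite -[RHS](IH f'); apply: expect_eq => h.
rewrite sum_stage !big_bool /= !stage_weightE /= /f' !big_bool -bel_public
  state_weightC !state_weight_rcons /= /public_history !map_rcons /=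
  !belief_after_rcons -/(public_history h) /belief_strategy.
have Dt := belief_afterD [seq ian_move x | x <- h].
have b1 := next_bayes true Dt; have b0 := next_bayes false Dt.
set t := bel h in Dt b1 b0 *.
(* Bayes' rule: [B] averages to 0 under the belief [t]. The sum over the stage is affine in the true
   probability [w], hence a public multiple of [w - t]. *)
have K i : B t false i + t * (B t true i - B t false i) = 0.
  case: i; [move: b1|move: b0]; rewrite /B /move_prob /bernoulli_weight /=; lra.
set w := state_weight p h true; set ph := public_history h.
transitivity (
  (\sum_(u : bool) \sum_(i : bool) bernoulli_weight (tau ph) u * f (rcons ph (i, u))
     * (B t true i - B t false i)) * (w - t)
  + \sum_(u : bool) \sum_(i : bool) bernoulli_weight (tau ph) u * f (rcons ph (i, u))
     * (B t false i + t * (B t true i - B t false i))).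
  by rewrite !big_bool /= /B /=; ring.
by rewrite !big_bool /= !K !mulr0 !addr0.
Qed.

(* The hidden state has been averaged out in the hypothesis, so that only the
   belief matters: this is what [expect_belief] provides.  The factor [k] is
   meant to be [1] or [-1], giving lower and upper bounds. *)
Lemma expect_belief_potential N (k v : R) (W : R -> R) :
  (forall theta u, D theta ->
     v + W theta <= k * mean_payoff theta u
       + \sum_(i : bool) move_prob theta i * W (next theta i)) ->
  N%:R * v + W 2^-1 <= EE N (fun h => k * total_payoff R h + W (bel h)).
Proof.
move=> HW; elim: N => [|N IH].
  by rewrite expect0 /total_payoff big_nil mulr0 !add0r mul0r add0r lexx.
rewrite expect_payoffS.
(* [g s m] is the expected gain of a stage in state [s]. Replacing the true state probability by the
   belief leaves the correction [f] times their difference, whose expectation is 0 by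
   [expect_belief]. *)
pose g s (m : seq (bool * bool)) : R := let t := belief_after (map fst m) in
  \sum_(u : bool) \sum_(i : bool) bernoulli_weight (tau m) u *
    bernoulli_weight (if s then (act t).2 else (act t).1) i *
    (k * payoff R (i, u, s) + W (next t i)).
pose f m := g true m - g false m.
rewrite (_ : EE N _ = EE N (fun h => k * total_payoff R h +
    ((1 - bel h) * g false (public_history h) + bel h * g true (public_history h))
    + f (public_history h) * (state_weight p h true - bel h))); last first.
  apply: expect_eq => h; rewrite -!addrA; congr (_ + _).
  rewrite sum_stage !big_bool /= !stage_weightE /= /f /g !big_bool -bel_public
   state_weightC !map_rcons /= !belief_after_rcons /belief_strategy /=.
  by ring.
rewrite expectD expect_belief addr0.
apply: (@le_trans _ _ (EE N (fun h => v + (k * total_payoff R h + W (bel h))))).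
  by rewrite expectD expect_cst // -natr1 mulrDl mul1r; move: IH; lra.
apply: expect_le => // h.
rewrite [X in X <= _]addrCA lerD2l.
rewrite /g -bel_public.
have Dt := belief_afterD [seq ian_move x | x <- h].
have ht := tauP (public_history h).
have := HW _ true Dt; have := HW _ false Dt.
rewrite !big_bool /= /move_prob /mean_payoff /payoff /bernoulli_weight /=.
set t := bel h; set q := tau _ in ht *.
set w1 := W _; set w2 := W _; set w3 := W _ => h0 h1.
have : (1 - q) * (v + w1) + q * (v + w1) <= 
  (1 - q) * (k * ((1 - t) * (1 - (act t).1)) +
     (((1 - t) * (act t).1 + t * (act t).2) * w2 +
      ((1 - t) * (1 - (act t).1) + t * (1 - (act t).2)) * w3))
  + q * (k * (t * (act t).2) +
     (((1 - t) * (act t).1 + t * (act t).2) * w2 +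
      ((1 - t) * (1 - (act t).1) + t * (1 - (act t).2)) * w3)).
  move/andP: ht => [q0 q1].
  by apply: lerD; apply: ler_wpM2l => //; lra.
rewrite -mulrDl subrK mul1r => /le_trans; apply; rewrite le_eqVlt; apply/orP; left; apply/eqP; ring.
Qed.

End BeliefStrategy.

(** * Upper bounds from an automaton of Una *)

Section UnaCertificate.
Variables (R : realType) (Q : Type) (p v C : R) (next : Q -> bool -> Q).
Variables (una_prob : Q -> R) (W : Q -> bool -> R) (D : Q -> Prop) (m0 : Q).

Definition memory_strategy : una_fun R :=
  fun m => una_prob (foldl next m0 (map fst m)).

Hypothesis p01 : 0 <= p <= 1.
Hypothesis D0 : D m0.
Hypothesis D_next : forall m i, D m -> D (next m i).
Hypothesis una01 : forall m, D m -> 0 <= una_prob m <= 1.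
Hypothesis W_bound : forall m s, D m -> `|W m s| <= C.
Hypothesis W_ineq : forall m s i, D m ->
  (if i == s then (if s then una_prob m else 1 - una_prob m) else 0)
  + (p * W (next m i) s + (1 - p) * W (next m i) (~~ s)) <= v + W m s.

Variable sigma : ian_fun R.
Hypothesis sigmaP : is_ian_strategy sigma.

Let mem (m : seq (bool * bool)) := foldl next m0 (map fst m).

Let memD m : D (mem m).
Proof.
rewrite /mem; elim/last_ind: (map fst m) => [|s i IH] //=.
by rewrite -cats1 foldl_cat; exact: D_next.
Qed.

(** Ian knows the state, so [W_ineq] is required for each state and each move; averaging over both
    gives the one-step inequality for [Z], the mean of [W] over the coming state. The two ends of
    the potential cost [2 * C]. *)
Lemma expect_memory_strategy_le N :
  expect p sigma memory_strategy N (total_payoff R) <= N%:R * v + 2 * C.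
Proof.
pose Z (h : seq stage) : R := let m := mem (public_history h) in
  state_weight p h false * W m false + state_weight p h true * W m true.
have tauP : is_una_strategy memory_strategy by move=> m; apply: una01; exact: memD.
have Zb h : `|Z h| <= C.
  rewrite /Z state_weightC.
  have w0 := state_weight_ge0 p01 h true; have w1 := state_weight_ge0 p01 h false.
  rewrite state_weightC in w1.
  have := W_bound false (memD (public_history h)).
  have := W_bound true (memD (public_history h)).
  rewrite !ler_norml => /andP[? ?] /andP[? ?]; apply/andP; split; nra.
have H h : \sum_x stage_weight p sigma memory_strategy h x *
    (payoff R x + Z (rcons h x)) <= v + Z h.
  rewrite sum_stage !big_bool /= !stage_weightE /= /payoff /= /Z !(state_weightC p h).
  rewrite !state_weight_rcons /= /public_history !map_rcons /= /mem !map_rcons /=.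
  rewrite -/(public_history h) -!cats1 !foldl_cat /= -/(mem (public_history h)).
  rewrite /memory_strategy -/(mem (public_history h)).
  have Dm := memD (public_history h).
  set m := mem (public_history h) in Dm *.
  have h00 := W_ineq false false Dm; have h01 := W_ineq false true Dm.
  have h10 := W_ineq true false Dm; have h11 := W_ineq true true Dm.
  move: h00 h01 h10 h11; rewrite /bernoulli_weight /=.
  set a0 := W (next m false) false; set b0 := W (next m false) true.
  set a1 := W (next m true) false; set b1 := W (next m true) true.
  set a := W m false; set b := W m true; set t := una_prob m.
  have w0 := state_weight_ge0 p01 h true; have w1 := state_weight_ge0 p01 h false.
  rewrite state_weightC in w1.
  set w := state_weight p h true in w0 w1 *.
  have [/andP[f0 f1] /andP[g0 g1]] := sigmaP h.
  set q0 := (sigma h).1 in f0 f1 *; set q1 := (sigma h).2 in g0 g1 *.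
  move=> h00 h01 h10 h11.
  have k0 : (1 - q0) * ((1 - t) + (p * a0 + (1 - p) * b0))
       + q0 * (0 + (p * a1 + (1 - p) * b1)) <= (1 - q0) * (v + a) + q0 * (v + a).
    by apply: lerD; apply: ler_wpM2l => //; lra.
  have k1 : (1 - q1) * (0 + (p * b0 + (1 - p) * a0))
       + q1 * (t + (p * b1 + (1 - p) * a1)) <= (1 - q1) * (v + b) + q1 * (v + b).
    by apply: lerD; apply: ler_wpM2l => //; lra.
  have : (1 - w) * ((1 - q0) * ((1 - t) + (p * a0 + (1 - p) * b0))
       + q0 * (0 + (p * a1 + (1 - p) * b1))) + w * ((1 - q1) * (0 + (p * b0 + (1 - p) * a0))
       + q1 * (t + (p * b1 + (1 - p) * a1))) <= (1 - w) * ((1 - q0) * (v + a) + q0 * (v + a))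
       + w * ((1 - q1) * (v + b) + q1 * (v + b)).
    by apply: lerD; apply: ler_wpM2l.
  rewrite [X in _ <= X](_ : _ = v + ((1 - w) * a + w * b)); last by ring.
  by move=> k; apply: (le_trans _ k); rewrite le_eqVlt; apply/orP; left; apply/eqP; ring.
have := expect_potential_le p01 sigmaP tauP N H.
rewrite expectD.
have := Zb [::]; rewrite ler_norml => /andP[_ Z0].
have : - C <= expect p sigma memory_strategy N Z.
  rewrite -(expect_cst p sigma memory_strategy N (- C)); apply: expect_le => // h.
  by have := Zb h; rewrite ler_norml => /andP[].
by lra.
Qed.

End UnaCertificate.

(** * The transfer operator on kinks *)

Section Kinks.
Variables (R : realType) (p : R).
Hypothesis p_ge : 2^-1 <= p.
Hypothesis p_lt1 : p < 1.

Ltac plra := move: p_ge p_lt1 => ? ?; lra.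

(** The belief after the non-revealing move at a belief x <= 1/2; it may exceed 1/2. *)
Definition upd (x : R) : R := (1 - p + (3 * p - 2) * x) / (1 - x).
(** [pre] inverts [upd], and (1 - x)(z - upd x) equals [pre_weight z] times (pre z - x): a kink at z
    is pulled back to a kink at [pre z] with this weight. *)
Definition pre_weight (z : R) : R := z + 3 * p - 2.
Definition pre (z : R) : R := (z - (1 - p)) / pre_weight z.

(** A preimage below 1 - p is dropped, because its hinge vanishes on all folded beliefs. *)
Definition branch (f : R -> R) (z : R) : R :=
  if 1 - p <= pre z then pre_weight z * f (pre z) else 0.
Definition transfer (f : R -> R) (y : R) : R := branch f y + branch f (1 - y).
(** Kinks are handled by duality: the operator acts on test functions, and [level n f] is the sum of
    weight times [f] over the n-th generation of preimages of 1/2. *)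
Definition level (n : nat) (f : R -> R) : R := iter n transfer f 2^-1.
Definition kinks (n : nat) (f : R -> R) : R := \sum_(j < n.+1) level j f.

Definition folded (y : R) : Prop := 1 - p <= y <= 2^-1.

Lemma folded_half : folded 2^-1.
Proof. by have h : 1 - p <= 2^-1 :> R by [plra]; rewrite /folded lexx andbT. Qed.

Lemma pre_weight_ge0 z : 1 - p <= z -> 0 <= pre_weight z.
Proof. by rewrite /pre_weight => ?; plra. Qed.

(** The only degenerate case; there the convention x / 0 = 0 gives [pre] the value 0. *)
Lemma pre_weight_eq0 z : 1 - p <= z -> pre_weight z = 0 -> z = 1 - p /\ p = 2^-1.
Proof. by rewrite /pre_weight => ? ?; split; plra. Qed.

Lemma pre_le_half z : 1 - p <= z <= p -> pre z <= 2^-1.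
Proof.
move=> /andP[z1 z2]; have := pre_weight_ge0 z1; rewrite le_eqVlt => /orP[/eqP w0|w0].
  by rewrite /pre -w0 invr0 mulr0 invr_ge0.
by rewrite /pre ler_pdivrMr // /pre_weight; plra.
Qed.

Lemma branch_le f g z : 1 - p <= z <= p ->
  (forall y, folded y -> f y <= g y) -> branch f z <= branch g z.
Proof.
move=> hz fg; rewrite /branch; case: ifP => // h; apply: ler_wpM2l.
  by apply: pre_weight_ge0; case/andP: hz.
by apply: fg; rewrite /folded h pre_le_half.
Qed.

Lemma folded_itv y : folded y -> (1 - p <= y <= p) /\ (1 - p <= 1 - y <= p).
Proof. by move=> /andP[? ?]; split; apply/andP; split; plra. Qed.

Lemma transfer_le f g y : folded y -> (forall y, folded y -> f y <= g y) ->
  transfer f y <= transfer g y.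
Proof.
by move=> /folded_itv[h1 h2] fg; apply: lerD; exact: branch_le.
Qed.

Lemma level_le n (f g : R -> R) : (forall y, folded y -> f y <= g y) -> level n f <= level n g.
Proof.
move=> fg; rewrite /level; have := folded_half; move: (2^-1 : R).
by elim: n => [|n IH] y hy //=; [exact: fg|exact: transfer_le].
Qed.

Lemma levelSr n f : level n.+1 f = level n (transfer f).
Proof. by rewrite /level iterSr. Qed.

Lemma transfer_lin a b f g : transfer (fun y => a * f y + b * g y) =
  (fun y => a * transfer f y + b * transfer g y).
Proof.
by apply/funext => y; rewrite /transfer /branch; do 2 case: ifP => _; ring.
Qed.

Lemma level_lin n a b f g :
  level n (fun y => a * f y + b * g y) = a * level n f + b * level n g.
Proof. by elim: n f g => [|n IH] f g //; rewrite !levelSr transfer_lin IH. Qed.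

Lemma kinks_le n (f g : R -> R) : (forall y, folded y -> f y <= g y) -> kinks n f <= kinks n g.
Proof. by move=> fg; apply: ler_sum => j _; exact: level_le. Qed.

Lemma kinks_eq n f g : (forall y, folded y -> f y = g y) -> kinks n f = kinks n g.
Proof. by move=> fg; apply/le_anti/andP; split; apply: kinks_le => y /fg ->. Qed.

Lemma kinks_lin n a b f g :
  kinks n (fun y => a * f y + b * g y) = a * kinks n f + b * kinks n g.
Proof.
rewrite /kinks !mulr_sumr -big_split; apply: eq_bigr => j _; exact: level_lin.
Qed.

Lemma kinksD n f g : kinks n (fun y => f y + g y) = kinks n f + kinks n g.
Proof.
have -> : (fun y => f y + g y) = (fun y => 1 * f y + 1 * g y).
  by apply/funext => y; rewrite !mul1r.
by rewrite kinks_lin !mul1r.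
Qed.

Lemma kinksZ n a f : kinks n (fun y => a * f y) = a * kinks n f.
Proof.
rewrite -[RHS]addr0 -(mul0r (kinks n f)) -kinks_lin.
by congr kinks; apply/funext => y; rewrite mul0r addr0.
Qed.

Lemma kinksB n f g : kinks n (fun y => f y - g y) = kinks n f - kinks n g.
Proof.
rewrite -[RHS]/(kinks n f + - kinks n g) -mulN1r -kinksZ -kinksD.
by congr kinks; apply/funext => y; rewrite mulN1r.
Qed.

Lemma kinks0 n : kinks n (fun=> 0) = 0.
Proof.
rewrite (_ : (fun=> 0) = (fun y : R => 0 * y)) ?kinksZ ?mul0r //.
by apply/funext => y; rewrite mul0r.
Qed.

Lemma kinks_ge0 n (f : R -> R) : (forall y, folded y -> 0 <= f y) -> 0 <= kinks n f.
Proof. by move=> f0; rewrite -(kinks0 n); exact: kinks_le. Qed.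

Lemma kinks_ge n (f : R -> R) : (forall y, folded y -> 0 <= f y) -> f 2^-1 <= kinks n f.
Proof.
move=> f0; rewrite /kinks big_ord_recl /= lerDl; apply: sumr_ge0 => j _.
have -> : 0 = level (bump 0 j) (fun=> 0).
  elim: (bump 0 j) => // k IH; rewrite levelSr [LHS]IH; congr level.
  by apply/funext => y; rewrite /transfer /branch; do 2 case: ifP => _; rewrite ?mulr0 addr0.
exact: level_le.
Qed.

(** Shifting all generations by one loses the kink at 1/2 and gains generation n + 1, which becomes
    the truncation error. *)
Lemma kinks_transfer n f :
  kinks n (transfer f) = kinks n f - f 2^-1 + level n.+1 f.
Proof.
have -> : kinks n (transfer f) = \sum_(j < n.+1) level j.+1 f.
  by apply: eq_bigr => j _; rewrite levelSr.
rewrite big_ord_recr /kinks big_ord_recl /= -[level 0 f]/(f 2^-1).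
by rewrite [X in X - _]addrC addrK.
Qed.

(** The flag decides whether a kink exactly at [x] counts: [true] corresponds to the left derivative
    of a hinge at its kink, [false] to the right one. *)
Definition le_tie (s : bool) (x y : R) : bool := if s then x <= y else x < y.
Definition above (s : bool) (x y : R) : R := (le_tie s x y)%:R.

Lemma le_tie_upd s x z : 0 < pre_weight z -> x < 1 ->
  le_tie s (upd x) z = le_tie s x (pre z).
Proof.
move=> w0 x1; have x0 : 0 < 1 - x by plra.
rewrite /le_tie /upd /pre; case: s.
  by rewrite ler_pdivrMr // ler_pdivlMr // /pre_weight; apply/idP/idP; plra.
by rewrite ltr_pdivrMr // ltr_pdivlMr // /pre_weight; apply/idP/idP; plra.
Qed.

(** The counterpart of [branch_hinge] for derivatives: [pre_weight z] clears the denominator of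
    [pre z], so an affine function cut at [x] becomes an affine function cut at [upd x]. *)
Lemma branch_above (c d : R) s x z : folded x -> 1 - p <= z ->
  branch (fun y => (c + d * y) * above s x y) z =
  (c * pre_weight z + d * (z - (1 - p))) * above s (upd x) z.
Proof.
move=> /andP[x1 x2] z1.
have := pre_weight_ge0 z1; rewrite le_eqVlt => /orP[/eqP/esym w0|w0].
  have [zq _] := pre_weight_eq0 z1 w0.
  rewrite w0 zq subrr !mulr0 addr0 mul0r /branch -zq.
  by rewrite w0 mul0r if_same.
rewrite /branch /above le_tie_upd //; last plra.
have e : pre_weight z * pre z = z - (1 - p) by rewrite mulrC divfK // gt_eqF.
case: ifP => h; first by rewrite -e; ring.
rewrite (_ : le_tie s x (pre z) = false) ?mulr0 //.
by apply/negbTE; move/negbT: h; rewrite -ltNge /le_tie; case: s; plra.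
Qed.

Lemma transfer_above (c d : R) s x y : folded x -> folded y ->
  transfer (fun y => (c + d * y) * above s x y) y =
  (c * (y + 3 * p - 2) + d * (y - (1 - p))) * above s (upd x) y
  + (c * (3 * p - 1 - y) + d * (p - y)) * above s (upd x) (1 - y).
Proof.
move=> hx /folded_itv[/andP[h1 _] /andP[h2 _]].
by rewrite /transfer !branch_above // /pre_weight; congr (_ * _ + _ * _); ring.
Qed.

(** The factor 1 - x, the probability of the non-revealing move, clears the denominator of [upd x];
    so one stage turns a hinge into a weighted hinge. *)
Lemma branch_hinge x z : folded x -> 1 - p <= z ->
  branch (fun y => Num.max 0 (y - x)) z = (1 - x) * Num.max 0 (z - upd x).
Proof.
move=> /andP[x1 x2] z1.
have xgt : 0 < 1 - x by plra.
have e : (1 - x) * (z - upd x) = z - (1 - p) - pre_weight z * x.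
  have e0 : (1 - x) * upd x = 1 - p + (3 * p - 2) * x by rewrite mulrC divfK ?gt_eqF.
  by rewrite mulrBr e0 /pre_weight; ring.
rewrite -{1}[0](mulr0 (1 - x)).
rewrite maxr_pMr ?ltW // mulr0 e.
have := pre_weight_ge0 z1; rewrite le_eqVlt => /orP[/eqP/esym w0|w0].
  have [zq _] := pre_weight_eq0 z1 w0.
  by rewrite /branch w0 !mul0r if_same zq subrr subr0 maxxx.
have ew : pre_weight z * pre z = z - (1 - p) by rewrite mulrC divfK // gt_eqF.
rewrite -ew -mulrBr /branch; case: ifP => h.
  by rewrite maxr_pMr ?ltW // mulr0.
move/negbT: h; rewrite -ltNge => h.
by rewrite max_l //; apply: mulr_ge0_le0; plra.
Qed.

End Kinks.

(** * The belief chain under [sigma_star] *)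

Section SigmaStar.
Variables (R : realType) (p : R).
Hypothesis p_ge : 2^-1 <= p.
Hypothesis p_lt1 : p < 1.

Ltac plra := move: p_ge p_lt1 => ? ?; lra.

Definition fold_belief (theta : R) : R := Num.min theta (1 - theta).

Lemma fold_beliefC theta : fold_belief (1 - theta) = fold_belief theta.
Proof. by rewrite /fold_belief subKr minC. Qed.

Lemma fold_belief_low theta : theta <= 2^-1 -> fold_belief theta = theta.
Proof. by move=> h; rewrite /fold_belief min_l //; lra. Qed.

Lemma fold_belief_high theta : 2^-1 <= theta -> fold_belief theta = 1 - theta.
Proof. by move=> h; rewrite /fold_belief min_r //; lra. Qed.

Lemma folded_fold theta : 1 - p <= theta <= p -> folded p (fold_belief theta).
Proof.
move=> /andP[h1 h2]; rewrite /folded; have [h|/ltW h] := leP theta 2^-1.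
  by rewrite fold_belief_low // h1 h.
by rewrite fold_belief_high//; apply/andP; split; lra.
Qed.

Lemma updP x : folded p x -> (1 - x) * upd p x = 1 - p + (3 * p - 2) * x.
Proof. by move=> /andP[x1 x2]; rewrite mulrC divfK // gt_eqF //; lra. Qed.

Lemma upd_itv x : folded p x -> 1 - p <= upd p x <= p.
Proof.
move=> /andP[x1 x2]; have xgt : 0 < 1 - x by lra.
rewrite /upd ler_pdivlMr // ler_pdivrMr //; move: p_ge p_lt1 => ? ?.
by apply/andP; split; nra.
Qed.

Definition star_act (theta : R) : R * R :=
  if theta <= 2^-1 then ((1 - 2 * theta) / (1 - theta), 1)
  else (0, (1 - theta) / theta).

Lemma sigma_starE : sigma_star p = belief_strategy star_act (belief_step p).
Proof. by []. Qed.

Lemma belief_f1_low theta : theta <= 2^-1 -> belief_f1 p theta = upd p theta.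
Proof.
move=> h; rewrite /belief_f1 /upd; have [h'|h'] := leP 2^-1 theta.
  have -> : theta = 2^-1 by lra.
  by field; lra.
by field; lra.
Qed.

Lemma belief_f0_low theta : theta <= 2^-1 -> belief_f0 p theta = 1 - p.
Proof.
move=> h; rewrite /belief_f0; have [h'|//] := leP 2^-1 theta.
have -> : theta = 2^-1 by lra.
by field.
Qed.

Lemma belief_f1_high theta : 2^-1 <= theta -> belief_f1 p theta = p.
Proof. by move=> h; rewrite /belief_f1 h. Qed.

Lemma belief_f0_high theta : 2^-1 <= theta -> belief_f0 p theta = 1 - upd p (1 - theta).
Proof. by move=> h; rewrite /belief_f0 h /upd; field; lra. Qed.

Definition belief_dom (theta : R) : Prop := 1 - p <= theta <= p.

Lemma belief_dom_half : belief_dom 2^-1.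
Proof. by apply/andP; split; plra. Qed.

Lemma belief_dom_step theta i : belief_dom theta -> belief_dom (belief_step p theta i).
Proof.
move=> /andP[h1 h2]; rewrite /belief_step; have [h|/ltW h] := leP theta 2^-1.
  case: i; last by rewrite belief_f0_low //; apply/andP; split; plra.
  by rewrite belief_f1_low //; apply: upd_itv; apply/andP; split; lra.
case: i; first by rewrite belief_f1_high//; apply/andP; split; plra.
have /andP[u1 u2] : 1 - p <= upd p (1 - theta) <= p.
  by apply: upd_itv; apply/andP; split; lra.
by rewrite belief_f0_high//; apply/andP; split; lra.
Qed.

Lemma star_move_prob theta i : belief_dom theta -> move_prob star_act theta i =
  if i == (theta <= 2^-1) then 1 - fold_belief theta else fold_belief theta.
Proof.
move=> /andP[h1 h2]; rewrite /move_prob /star_act; have [h|/ltW h] := leP theta 2^-1.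
  by rewrite fold_belief_low //=; case: i => /=; field; plra.
by rewrite fold_belief_high//=; case: i => /=; field; plra.
Qed.

Lemma star_mean_payoff theta u : belief_dom theta ->
  mean_payoff star_act theta u = fold_belief theta.
Proof.
move=> /andP[h1 h2]; rewrite /mean_payoff /star_act; have [h|/ltW h] := leP theta 2^-1.
  by rewrite fold_belief_low //=; case: u => /=; field; plra.
by rewrite fold_belief_high//=; case: u => /=; field; plra.
Qed.

Lemma star_bayes theta i : belief_dom theta ->
  move_prob star_act theta i * belief_step p theta i =
  (1 - p) * ((1 - theta) * bernoulli_weight (star_act theta).1 i)
  + p * (theta * bernoulli_weight (star_act theta).2 i).
Proof.
move=> Dt; rewrite star_move_prob //; case/andP: Dt => h1 h2.
rewrite /belief_step /star_act; have [h|/ltW h] := leP theta 2^-1.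
  rewrite fold_belief_low //; case: i => /=.
    rewrite belief_f1_low // updP; last by apply/andP.
    by field; plra.
  by rewrite belief_f0_low //; field; plra.
rewrite fold_belief_high//; case: i => /=.
  by rewrite belief_f1_high//; field; plra.
rewrite belief_f0_high// subKr mulrBr -{2}[theta](subKr 1) updP; last first.
  by apply/andP; split; lra.
by field; plra.
Qed.

Lemma star_step (w : R -> R) theta : belief_dom theta ->
  \sum_(i : bool) move_prob star_act theta i * w (fold_belief (belief_step p theta i)) =
  let x := fold_belief theta in x * w (1 - p) + (1 - x) * w (fold_belief (upd p x)).
Proof.
move=> Dt; rewrite big_bool /= !star_move_prob //; case/andP: Dt => h1 h2.
rewrite /belief_step; have [h|/ltW h] := leP theta 2^-1.
  rewrite belief_f1_low // belief_f0_low // fold_belief_low //.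
  by rewrite [fold_belief (1 - p)]fold_belief_low /=; [rewrite addrC|plra].
rewrite belief_f1_high // belief_f0_high // fold_belief_high //.
by rewrite fold_beliefC [fold_belief p]fold_belief_high /=; [|plra].
Qed.

(** Una influences neither the expected payoff nor the belief chain, so a function of the folded
    belief serves as potential. *)
Lemma sigma_star_bound (k v C : R) (w : R -> R) tau N :
  is_una_strategy tau ->
  (forall x, folded p x -> `|w x| <= C) ->
  (forall x, folded p x ->
     v + w x <= k * x + (x * w (1 - p) + (1 - x) * w (fold_belief (upd p x)))) ->
  N%:R * v - 2 * C <= k * expect p (sigma_star p) tau N (total_payoff R).
Proof.
move=> tauP wC wE.
have p01 : 0 <= p <= 1 by apply/andP; split; plra.
have sP := sigma_star_is_strategy p01.
have HW theta u : belief_dom theta -> v + w (fold_belief theta) <=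
    k * mean_payoff star_act theta u +
    \sum_(i : bool) move_prob star_act theta i * w (fold_belief (belief_step p theta i)).
  by move=> Dt; rewrite star_mean_payoff // star_step //; apply/wE/folded_fold.
have := expect_belief_potential p01 sP belief_dom_half belief_dom_step star_bayes
  tauP N (W := w \o fold_belief) HW.
rewrite -sigma_starE expectD expectZ /=.
have : `|w (fold_belief 2^-1)| <= C by apply/wC/folded_fold/belief_dom_half.
rewrite ler_norml => /andP[w0 _].
set E := expect p _ tau N (fun h => w _).
have : E <= C.
  rewrite -(expect_cst p (sigma_star p) tau N C); apply: expect_le => // h.
  have : `|w (fold_belief (belief_after (belief_step p) [seq ian_move x | x <- h]))| <= C.
    by apply/wC/folded_fold/(belief_afterD belief_dom_half belief_dom_step).
  by rewrite ler_norml => /andP[].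
by lra.
Qed.

End SigmaStar.

(** * Approximate bias and Una's automaton *)

Section Certificate.
Variables (R : realType) (p : R) (n : nat).
Hypothesis p_ge : 2^-1 <= p.
Hypothesis p_lt1 : p < 1.

Ltac plra := move: p_ge p_lt1 => ? ?; lra.

Local Notation K := (kinks p n).

(** This normalisation cancels the terms linear in x in [bias_equation]; the remaining constant is
    [approx_value], in the form given by [approx_valueE]. *)
Definition kink_scale : R := (1 + 2 * (2 * p - 1) * K (fun=> 1))^-1.
Definition approx_value : R := 2^-1 - kink_scale * K (fun y => y - (1 - p)).
Definition approx_error : R := kink_scale * level p n.+1 (fun=> 1).

Lemma kinks_affine (c d : R) (f : R -> R) : (forall y, folded p y -> f y = c + d * y) ->
  K f = c * K (fun=> 1) + d * K (fun y => y).
Proof.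
move=> h; rewrite -kinks_lin; apply: kinks_eq => // y /h ->.
by rewrite mulr1.
Qed.

Lemma kinks1_ge1 : 1 <= K (fun=> 1).
Proof. by apply: (kinks_ge p_ge p_lt1 n (f := fun=> 1)) => y _; exact: ler01. Qed.

Lemma kink_scale_gt0 : 0 < kink_scale.
Proof.
rewrite invr_gt0; have m1 := kinks1_ge1; move: p_ge => ?; nra.
Qed.

Lemma kink_scale_le1 : kink_scale <= 1.
Proof.
rewrite invf_le1; have m1 := kinks1_ge1; move: p_ge => ?; nra.
Qed.

Lemma kink_scaleE : kink_scale * (1 + 2 * (2 * p - 1) * K (fun=> 1)) = 1.
Proof.
by rewrite mulVf // gt_eqF //; have m1 := kinks1_ge1; move: p_ge => ?; nra.
Qed.

Lemma approx_valueE : approx_value = kink_scale * (2^-1 + K (fun y => p - y)).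
Proof.
have := kink_scaleE; rewrite /approx_value.
rewrite (kinks_affine (f := fun y => y - (1 - p)) (c := - (1 - p)) (d := 1)); last by move=> y _; ring.
rewrite (kinks_affine (f := fun y => p - y) (c := p) (d := -1)); last by move=> y _; ring.
by lra.
Qed.

Definition hinge (x y : R) : R := Num.max 0 (y - x).
Definition bias (x : R) : R := - (kink_scale * K (hinge x)).

(** Unfolded, the hinge has kinks at y and 1 - y. The affine term corrects the slope: the two hinges
    together start with slope -2 instead of -1. *)
Lemma hinge_fold x y : y <= 2^-1 ->
  hinge (fold_belief x) y = hinge x y + hinge x (1 - y) - (1 - y - x).
Proof.
move=> hy; rewrite /hinge; have [h|/ltW h] := leP x 2^-1.
  rewrite fold_belief_low // [X in _ + X - _]max_r; last by lra.
  by ring.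
rewrite fold_belief_high // [X in X + _ - _]max_l; last by lra.
have [h1|h1] := leP (y - (1 - x)) 0.
  by rewrite [X in _ + X - _]max_r; lra.
by rewrite [X in _ + X - _]max_l; lra.
Qed.

(** One stage carries each generation of kinks to the next, so the sums match except for the kink at
    1/2, used up by the payoff through [kink_scale], and the first omitted generation. *)
Lemma bias_equation x : folded p x ->
  x + x * bias (1 - p) + (1 - x) * bias (fold_belief (upd p x)) =
  bias x + approx_value - kink_scale * level p n.+1 (hinge x).
Proof.
move=> hx; have [x1 x2] := andP hx; rewrite /bias.
have -> : K (hinge (1 - p)) = K (fun y => y - (1 - p)).
  by apply: kinks_eq => // y /andP[y1 y2]; rewrite /hinge max_r //; lra.
have E : (1 - x) * K (hinge (fold_belief (upd p x))) =
    K (transfer p (hinge x)) - K (fun y => p - y - (3 * p - 1 - y) * x).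
  rewrite -kinksZ -kinksB.
  apply: kinks_eq => // y hy; have [y1 y2] := andP hy.
  have [/andP[i1 _] /andP[i2 _]] := folded_itv p_ge p_lt1 hy.
  rewrite hinge_fold // /transfer !branch_hinge // -/(hinge _ _) -/(hinge _ _).
  rewrite mulrBr mulrDr mulrBr updP //.
  by ring.
rewrite (_ : (1 - x) * - _ = - (kink_scale *
    ((1 - x) * K (hinge (fold_belief (upd p x)))))); last by ring.
rewrite E kinks_transfer /approx_value.
have -> : hinge x 2^-1 = 2^-1 - x by rewrite /hinge max_r //; lra.
have := kink_scaleE.
rewrite (kinks_affine (f := fun y => y - (1 - p)) (c := - (1 - p)) (d := 1)); last by move=> y _; ring.
rewrite (kinks_affine (f := fun y => p - y - (3 * p - 1 - y) * x)
  (c := p - (3 * p - 1) * x) (d := x - 1)); last by move=> y _; ring.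
set m := K _; set l := K _ => e.
(* Multiplied by x - 1/2, the defining equation of the scale removes all remaining terms in x. *)
have {}e : (x - 2^-1) * (kink_scale * (1 + 2 * (2 * p - 1) * m)) = x - 2^-1.
  by rewrite e mulr1.
by move: e; lra.
Qed.

Lemma level_hinge_le x : folded p x -> level p n.+1 (hinge x) <= level p n.+1 (fun=> 1).
Proof.
move=> /andP[x1 x2]; apply: level_le => // y /andP[y1 y2].
by rewrite /hinge ge_max ler01 /=; plra.
Qed.

Lemma bias_bound x : folded p x -> `|bias x| <= K (fun=> 1).
Proof.
move=> /andP[x1 x2]; rewrite /bias normrN normrM gtr0_norm ?kink_scale_gt0 //.
have k0 : 0 <= K (hinge x) by apply: kinks_ge0 => // y _; rewrite /hinge le_max lexx.
have k1 : K (hinge x) <= K (fun=> 1).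
  apply: kinks_le => // y /andP[y1 y2].
  by rewrite /hinge ge_max ler01 /=; plra.
rewrite ger0_norm //; apply: le_trans k1.
by rewrite ler_piMl // kink_scale_le1.
Qed.

Lemma sigma_star_guarantee tau N : is_una_strategy tau ->
  N%:R * (approx_value - approx_error) - 2 * K (fun=> 1)
    <= expect p (sigma_star p) tau N (total_payoff R).
Proof.
move=> tauP; rewrite -[X in _ <= X]mul1r.
apply: (sigma_star_bound p_ge p_lt1 (w := bias)) => // [|x hx].
  exact: bias_bound.
have := bias_equation hx.
have : kink_scale * level p n.+1 (hinge x) <= approx_error.
  by apply: ler_wpM2l; [exact: ltW kink_scale_gt0|exact: level_hinge_le].
by lra.
Qed.

(* Una's memory is a triple [(x, s, o)]: [x] is the belief if Ian follows
   [sigma_star], folded to [0, 1/2], [o] tells whether it has been folded, and [s]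
   selects one of the two one-sided tangents of the concave bias at [x].  The
   tangent is recorded by its values [tangent0] at belief 0 and [tangent1] at
   belief 1. *)
Definition tangent0 (x : R) (s : bool) : R :=
  - (kink_scale * K (fun y => (0 + 1 * y) * above s x y)).
Definition tangent1 (x : R) (s : bool) : R :=
  kink_scale * K (fun y => (1 + (-1) * y) * above s x y).

Definition una_memory : Type := (R * bool * bool)%type.

(** The move [i == o] is the revealing one and restarts the folded belief at 1 - p. Reflection at
    1/2 reverses the order, so the side of the tangent flips together with the orientation. *)
Definition una_next (m : una_memory) (i : bool) : una_memory :=
  let: (x, s, o) := m in
  if i == o then (1 - p, true, o)
  else if le_tie s (upd p x) 2^-1 then (upd p x, s, o)
  else (1 - upd p x, ~~ s, ~~ o).

(** For [o = false] this makes the revealing move in state S_0 yield exactly [approx_value] in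
    [una_inequality], with no error term. *)
Definition una_mix (m : una_memory) : R :=
  let: (x, s, o) := m in
  if o then 2^-1 + tangent0 x s else 2^-1 - tangent0 x s.

Definition una_potential (m : una_memory) (st : bool) : R :=
  let: (x, s, o) := m in if st == o then tangent0 x s else tangent1 x s.

Definition una_dom (m : una_memory) : Prop :=
  let: (x, s, o) := m in folded p x /\ le_tie s x 2^-1.

Lemma above_le1 s (x y : R) : 0 <= above s x y <= 1.
Proof. by rewrite /above; case: le_tie; rewrite ?lexx ?ler01. Qed.

Lemma le_tieN s (x y : R) : ~~ le_tie s x y = le_tie (~~ s) y x.
Proof. by rewrite /le_tie; case: s; rewrite /= ?leNgt ?negbK. Qed.

Lemma le_tieW s (x y : R) : le_tie s x y -> x <= y.
Proof. by rewrite /le_tie; case: s => // /ltW. Qed.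

Lemma le_tie_trans s (x y z : R) : le_tie s x y -> y <= z -> le_tie s x z.
Proof. by rewrite /le_tie; case: s => [/le_trans|/lt_le_trans]; apply. Qed.

Lemma le_tie_fold s (x y : R) : le_tie (~~ s) (1 - x) y = ~~ le_tie s x (1 - y).
Proof.
by rewrite /le_tie; case: s; rewrite /= -?ltNge -?leNgt; apply/idP/idP; lra.
Qed.

Lemma tangent_mix x s (c d : R) : c * tangent0 x s + d * tangent1 x s =
  kink_scale * K (fun y => (d - (c + d) * y) * above s x y).
Proof.
rewrite /tangent0 /tangent1 (_ : _ + _ = kink_scale *
  ((- c) * K (fun y => (0 + 1 * y) * above s x y) +
   d * K (fun y => (1 + (-1) * y) * above s x y))); last by ring.
by rewrite -kinks_lin; congr (_ * kinks _ _ _); apply/funext => y; ring.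
Qed.

Lemma una_dom_next m i : una_dom m -> una_dom (una_next m i).
Proof.
case: m => -[x s] o /= [hx tx]; case: ifP => _.
  by rewrite /= /folded /le_tie lexx /=; split; plra.
have /andP[u1 u2] := upd_itv p_ge p_lt1 hx.
case: ifP => h /=.
  by split => //; rewrite /folded u1 (le_tieW h).
have : le_tie (~~ s) 2^-1 (upd p x) by rewrite -le_tieN h.
move=> h'; have h2 := le_tieW h'.
split; first by apply/andP; split; lra.
by rewrite le_tie_fold (_ : 1 - 2^-1 = 2^-1) ?h //; lra.
Qed.

(** The first two parts treat the non-revealing move in S_0 and in S_1, by pulling the tangent at
    the new belief back to [x]. Combined with the first, the third bounds [tangent0] below by -1/2,
    so that [una_mix] is a probability. *)
Lemma una_potential_next x s : folded p x -> le_tie s x 2^-1 ->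
  let W := una_potential (una_next (x, s, false) true) in
  p * W false + (1 - p) * W true =
    tangent0 x s + approx_value
    - kink_scale * level p n.+1 (fun y => (0 + 1 * y) * above s x y) /\
  p * W true + (1 - p) * W false =
    kink_scale * K (fun y => (1 + (-2) * y) * above s x y)
    + kink_scale * level p n.+1 (fun y => (1 + (-2) * y) * above s x y)
    - kink_scale * K (fun y => y - (1 - p)) /\
  - (kink_scale * K (fun y => y - (1 - p))) <= p * W false + (1 - p) * W true.
Proof.
move=> hx tx W.
(* The kink at 1/2 is not cut off by [x], so its contribution in [kinks_transfer] is complete. *)
have half_above (c d : R) : c + d * 2^-1 = (c + d * 2^-1) * above s x 2^-1.
  by rewrite /above tx mulr1.
have Efirst : p * W false + (1 - p) * W true = kink_scale *
    K (fun y => p - y - ((y - (1 - p)) * above s (upd p x) y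
                         + (p - y) * above s (upd p x) (1 - y))).
  rewrite /W /=; case: ifP => h /=.
    rewrite tangent_mix; congr (_ * _); apply: kinks_eq => // y /andP[y1 y2].
    rewrite {3}/above (le_tie_trans h) ?mulr1; last by lra.
    by ring.
  rewrite addrC tangent_mix; congr (_ * _); apply: kinks_eq => // y /andP[y1 y2].
  rewrite /above le_tie_fold.
  have /negbTE -> : ~~ le_tie s (upd p x) y.
    by apply: contraFN h => /le_tie_trans; apply.
  by case: le_tie => /=; ring.
have Esecond : p * W true + (1 - p) * W false = kink_scale *
    K (fun y => (p - y) * above s (upd p x) y
                + (y - (1 - p)) * above s (upd p x) (1 - y) - (y - (1 - p))).
  rewrite /W /=; case: ifP => h /=.
    rewrite addrC tangent_mix; congr (_ * _); apply: kinks_eq => // y /andP[y1 y2].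
    rewrite {3}/above (le_tie_trans h) ?mulr1; last by lra.
    by ring.
  rewrite tangent_mix; congr (_ * _); apply: kinks_eq => // y /andP[y1 y2].
  rewrite /above le_tie_fold.
  have /negbTE -> : ~~ le_tie s (upd p x) y.
    by apply: contraFN h => /le_tie_trans; apply.
  by case: le_tie => /=; ring.
split.
  rewrite Efirst approx_valueE /tangent0.
  rewrite [X in kink_scale * X](_ : _ = K (fun y => p - y)
      - K (transfer p (fun y => (0 + 1 * y) * above s x y))); last first.
    rewrite -kinksB.
    by apply: kinks_eq => // y hy; rewrite transfer_above //; ring.
  by rewrite kinks_transfer -half_above; ring.
split; last first.
  rewrite Efirst -mulrN -[- K _]mulN1r -[-1 * K _]kinksZ.
  apply: ler_wpM2l; first exact: ltW kink_scale_gt0.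
  apply: kinks_le => // y /andP[y1 y2].
  have /andP[a0 a1] := above_le1 s (upd p x) y.
  have /andP[b0 b1] := above_le1 s (upd p x) (1 - y).
  have : (y - (1 - p)) * above s (upd p x) y <= y - (1 - p) by rewrite ler_piMr //; lra.
  have : (p - y) * above s (upd p x) (1 - y) <= p - y by rewrite ler_piMr //; plra.
  by lra.
rewrite Esecond.
rewrite [X in kink_scale * X](_ : _ =
    K (transfer p (fun y => (1 + (-2) * y) * above s x y))
    - K (fun y => y - (1 - p))); last first.
  rewrite -kinksB.
  by apply: kinks_eq => // y hy; rewrite transfer_above //; ring.
by rewrite kinks_transfer -half_above; field.
Qed.

Lemma level_ge0 (f : R -> R) : (forall y, folded p y -> 0 <= f y) -> 0 <= level p n.+1 f.
Proof.
move=> f0; have := @level_le _ _ p_ge p_lt1 n.+1 (fun y => 0 * f y + 0 * f y) f.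
by rewrite level_lin !mul0r addr0; apply=> y hy; rewrite !mul0r addr0; exact: f0.
Qed.

Lemma tangent0_le0 x s : tangent0 x s <= 0.
Proof.
rewrite oppr_le0; apply: mulr_ge0; first exact: ltW kink_scale_gt0.
apply: kinks_ge0 => // y /andP[y1 y2].
by have /andP[u1 _] := above_le1 s x y; apply: mulr_ge0 => //; plra.
Qed.

Lemma tangent1_ge0 x s : 0 <= tangent1 x s.
Proof.
apply: mulr_ge0; first exact: ltW kink_scale_gt0.
apply: kinks_ge0 => // y /andP[y1 y2].
by have /andP[u1 _] := above_le1 s x y; apply: mulr_ge0 => //; plra.
Qed.

Lemma tangent0_ge x s : folded p x -> le_tie s x 2^-1 -> - 2^-1 <= tangent0 x s.
Proof.
move=> hx tx; have [e1 [_ e3]] := una_potential_next hx tx.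
have : 0 <= kink_scale * level p n.+1 (fun y => (0 + 1 * y) * above s x y).
  apply: mulr_ge0; first exact: ltW kink_scale_gt0.
  apply: level_ge0 => y /andP[y1 y2].
  by have /andP[u1 _] := above_le1 s x y; apply: mulr_ge0 => //; plra.
by move: e3; rewrite e1 /approx_value; lra.
Qed.

Lemma una_mix01 m : una_dom m -> 0 <= una_mix m <= 1.
Proof.
case: m => -[x s] o /= [hx tx].
have := tangent0_ge hx tx; have := tangent0_le0 x s.
by case: o => ? ?; apply/andP; split; lra.
Qed.

Lemma una_potential_bound m st : una_dom m -> `|una_potential m st| <= K (fun=> 1).
Proof.
case: m => -[x s] o /= [hx tx]; have k1 := kinks1_ge1.
case: ifP => _.
  by rewrite ler0_norm ?tangent0_le0 //; have := tangent0_ge hx tx; lra.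
rewrite ger0_norm ?tangent1_ge0 // /tangent1.
have k0 : 0 <= K (fun y => (1 + -1 * y) * above s x y).
  by have := tangent1_ge0 x s; rewrite /tangent1 pmulr_rge0 ?kink_scale_gt0.
have : kink_scale * K (fun y => (1 + -1 * y) * above s x y) <=
    K (fun y => (1 + -1 * y) * above s x y).
  by rewrite ler_piMl // kink_scale_le1.
move=> /le_trans; apply; apply: kinks_le => // y /andP[y1 y2].
by have /andP[u1 u2] := above_le1 s x y; rewrite mulr_ile1 //; plra.
Qed.

Definition una_flip (m : una_memory) : una_memory := let: (x, s, o) := m in (x, s, ~~ o).

Lemma una_next_flip m i : una_next (una_flip m) i = una_flip (una_next m (~~ i)).
Proof.
by case: m => -[x s] o; case: i; case: o => //=; case: ifP.
Qed.

Lemma una_potential_flip m st : una_potential (una_flip m) st = una_potential m (~~ st).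
Proof. by case: m => -[x s] o; case: st; case: o. Qed.

Lemma una_mix_flip m : una_mix (una_flip m) = 1 - una_mix m.
Proof. by case: m => -[x s] [] /=; field. Qed.

Lemma una_reveal_values (c d : R) : c * tangent0 (1 - p) true + d * tangent1 (1 - p) true =
  kink_scale * K (fun y => d - (c + d) * y).
Proof.
rewrite tangent_mix; congr (_ * _); apply: kinks_eq => // y /andP[y1 _].
by rewrite /above /le_tie y1 mulr1.
Qed.

Lemma una_inequality m st i : una_dom m ->
  (if i == st then (if st then una_mix m else 1 - una_mix m) else 0)
  + (p * una_potential (una_next m i) st + (1 - p) * una_potential (una_next m i) (~~ st))
    <= approx_value + approx_error + una_potential m st.
Proof.
have err0 : 0 <= approx_error.
  by apply: mulr_ge0; [exact: ltW kink_scale_gt0|apply: level_ge0 => y _; exact: ler01].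
(* [una_flip] is the symmetry exchanging the two states and the two moves of each player. *)
wlog o0 : m st i / m.2 = false.
  move=> H; case: (boolP m.2) => [ho|/negbTE o0]; last exact: H.
  move=> Dm; have := H (una_flip m) (~~ st) (~~ i).
  rewrite una_next_flip !una_potential_flip una_mix_flip !negbK (inj_eq negb_inj).
  move: Dm ho; case: m => -[x s] o /= Dm -> /(_ erefl Dm).
  by apply: le_trans; rewrite lerD2r; case: (st) => /=; case: ifP => _; lra.
case: m o0 => -[x s] o /= o0; rewrite {o}o0 => -[hx tx].
(* After the revealing move every kink lies above the tangent point 1 - p. The inequality is then
   tight in S_0 and has slack in S_1. *)
case: i; last first.
  have e0 := una_reveal_values p (1 - p); have e1 := una_reveal_values (1 - p) p.
  case: st => /=.
    move: e1; rewrite addrC => ->.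
    rewrite approx_valueE; have := tangent1_ge0 x s; have := kink_scale_gt0.
    rewrite (kinks_eq p_ge p_lt1 n (g := fun y => p - y)); first by lra.
    by move=> y _; ring.
  rewrite e0 (kinks_eq p_ge p_lt1 n (g := fun y => -1 * (y - (1 - p)))); last first.
    by move=> y _; ring.
  by rewrite kinksZ; move: err0; rewrite /approx_value; lra.
have [e0 [e1 _]] := una_potential_next hx tx.
case: st => /=.
  rewrite e1.
  have : kink_scale * level p n.+1 (fun y => (1 + (-2) * y) * above s x y) <= approx_error.
    apply: ler_wpM2l; first exact: ltW kink_scale_gt0.
    apply: level_le => // y /andP[y1 y2].
    by have /andP[u1 u2] := above_le1 s x y; rewrite mulr_ile1 //; plra.
  have -> : tangent1 x s = kink_scale * K (fun y => (1 + -2 * y) * above s x y) - tangent0 x s.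
    rewrite /tangent1 /tangent0 opprK -mulrDr -kinksD; congr (_ * kinks _ _ _).
    by apply/funext => y; ring.
  by rewrite /approx_value; lra.
rewrite e0.
have : 0 <= kink_scale * level p n.+1 (fun y => (0 + 1 * y) * above s x y).
  apply: mulr_ge0; first exact: ltW kink_scale_gt0.
  apply: level_ge0 => y /andP[y1 y2].
  by have /andP[u1 _] := above_le1 s x y; apply: mulr_ge0 => //; plra.
by move: err0; lra.
Qed.

Definition una_strategy : una_fun R :=
  memory_strategy una_next una_mix (2^-1, true, false).

Lemma una_dom0 : una_dom (2^-1, true, false).
Proof. by split; [exact: folded_half|rewrite /le_tie lexx]. Qed.

Lemma una_strategyP : is_una_strategy una_strategy.
Proof.
move=> h; apply: una_mix01; elim/last_ind: (map fst h) => [|l i IH]; first exact: una_dom0.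
by rewrite -cats1 foldl_cat; exact: una_dom_next.
Qed.

Lemma una_strategy_guarantee sigma N : is_ian_strategy sigma ->
  expect p sigma una_strategy N (total_payoff R)
    <= N%:R * (approx_value + approx_error) + 2 * K (fun=> 1).
Proof.
move=> sP; have p01 : 0 <= p <= 1 by apply/andP; split; plra.
exact: (expect_memory_strategy_le p01 una_dom0 una_dom_next una_mix01
          una_potential_bound una_inequality sP).
Qed.

End Certificate.

(** * Decay of the kinks *)

Section Decay.
Variables (R : realType) (p : R).
Hypothesis p_ge : 2^-1 <= p.
Hypothesis p_lt1 : p < 1.

Ltac plra := move: p_ge p_lt1 => ? ?; lra.

(** The constant 1 is at most [phi / eta], and each application of the operator shrinks [phi] by the
    factor [r]. *)
Lemma level_test_function (phi : R -> R) (r eta : R) n :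
  0 <= r -> 0 < eta ->
  (forall y, folded p y -> eta <= phi y <= 1) ->
  (forall y, folded p y -> transfer p phi y <= r * phi y) ->
  level p n (fun=> 1) <= r ^+ n / eta.
Proof.
move=> r0 e0 phi1 phir.
have hl : level p n phi <= r ^+ n.
  elim: n => [|n IH].
    by rewrite expr0 /level /=; have /andP[] := phi1 _ (folded_half p_ge p_lt1).
  rewrite levelSr; apply: (@le_trans _ _ (level p n (fun y => r * phi y + 0 * phi y))).
    by apply: level_le => // y hy; rewrite mul0r addr0; exact: phir.
  by rewrite level_lin mul0r addr0 exprS; apply: ler_wpM2l.
rewrite ler_pdivlMr // mulrC; apply: le_trans hl.
rewrite -[X in X <= _]addr0 -(mul0r (level p n (fun=> 1))) -level_lin.
by apply: level_le => // y hy; rewrite mul0r addr0 mulr1; case/andP: (phi1 _ hy).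
Qed.

Lemma level_small_of_test (phi : R -> R) (r eta : R) :
  0 <= r < 1 -> 0 < eta ->
  (forall y, folded p y -> eta <= phi y <= 1) ->
  (forall y, folded p y -> transfer p phi y <= r * phi y) ->
  forall eps : R, 0 < eps -> exists n, level p n.+1 (fun=> 1) < eps.
Proof.
move=> /andP[r0 r1] e0 phi1 phir eps eps0.
have hc : (GRing.exp r @ \oo --> (0 : R))%classic.
  by apply: cvg_expr; rewrite ger0_norm.
have : (\forall n \near \oo, r ^+ n < eps * eta)%classic.
  have := cvgr0_norm_lt _ hc _ (mulr_gt0 eps0 e0).
  case=> m _ hm; exists m => // k /hm; rewrite /= ger0_norm ?exprn_ge0 //.
case=> m _ hm; exists m.
apply: le_lt_trans (level_test_function m.+1 r0 e0 phi1 phir) _.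
by rewrite ltr_pdivrMr //; apply: hm => /=.
Qed.

(* [y] has a preimage in [1 - p, 1/2] under the increasing part of the folded
   belief map. *)
Definition two_preimages (y : R) : bool := (1 - p) * (3 * p - 1) <= p * y.

Lemma pre_ge y : 0 < pre_weight p y -> (1 - p <= pre p y) = two_preimages y.
Proof.
move=> w0; rewrite /two_preimages /pre ler_pdivlMr // /pre_weight.
by apply/idP/idP; lra.
Qed.

Lemma pre_le_third y : y <= 2^-1 -> 0 < pre_weight p y -> pre p y <= 3^-1.
Proof. by move=> h w0; rewrite /pre ler_pdivrMr // /pre_weight; plra. Qed.

(** The preimage under the decreasing part x -> 1 - [upd p x] of the folded map. *)
Definition cpre (y : R) : R := pre p (1 - y).

Lemma cpreE y : cpre y = (p - y) / (3 * p - 1 - y).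
Proof. by rewrite /cpre /pre /pre_weight; congr (_ / _); ring. Qed.

Lemma transfer_two (f : R -> R) y : 2^-1 < p -> folded p y ->
  transfer p f y = (if two_preimages y then (y + 3 * p - 2) * f (pre p y) else 0)
    + (if 1 - p <= cpre y then (3 * p - 1 - y) * f (cpre y) else 0).
Proof.
move=> hp /andP[y1 y2]; rewrite /transfer /branch pre_ge; last by rewrite /pre_weight; lra.
by congr (_ + _); rewrite -/(cpre y); case: ifP => // _; rewrite /pre_weight; congr (_ * _); ring.
Qed.

End Decay.

(** * Kinks with two preimages *)

Section TwoPreimages.
Variables (R : realType) (p : R).
Hypothesis p_ge : 6 / 10 <= p.
Hypothesis p_le : p <= 18 / 25.

Local Notation two := (two_preimages p).
Local Notation c := ((1 - p) * (3 * p - 1)).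

Lemma two_le y z : y <= z -> two y -> two z.
Proof.
by move=> yz h; apply: le_trans h _; move: p_ge p_le => ? ?; rewrite ler_pM2l //; lra.
Qed.

Lemma not_two_third y : y <= 3^-1 -> ~~ two y.
Proof.
move=> h; apply/negP => /(two_le h); rewrite /two_preimages.
by move: p_ge p_le => ? ?; nra.
Qed.

(** [cpre] is decreasing and sends the threshold c / p to (2p - 1)/(3p - 1), which lies below the
    threshold. *)
Lemma not_two_cpre y : 1 - p <= y <= 2^-1 -> two y -> ~~ two (cpre p y).
Proof.
move=> /andP[y1 y2]; rewrite /two_preimages => hT; move: p_ge p_le => ? ?.
rewrite -ltNge cpreE mulrA ltr_pdivrMr; last by lra.
have h1 : c < p by nra.
have h2 : 0 <= (p - c) * (p * y - c) by apply: mulr_ge0; lra.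
have : p * (2 * p - 1) < c * (3 * p - 1) by nra.
by nra.
Qed.

End TwoPreimages.

(** The two weights add up to 6p - 3 <= 3/5, so the constant test function already contracts. *)
Lemma level_small_low (R : realType) (p : R) : 2^-1 <= p -> p <= 6 / 10 ->
  forall eps : R, 0 < eps -> exists n, level p n.+1 (fun=> 1) < eps.
Proof.
move=> p1 p2; have p3 : p < 1 by lra.
apply: (@level_small_of_test _ _ p1 p3 (fun=> 1) (9 / 10) 1) => //.
- by apply/andP; split; lra.
- by move=> y _; rewrite lexx.
move=> y /andP[y1 y2]; rewrite /transfer /branch /pre_weight.
by do 2 case: ifP => _ /=; lra.
Qed.

(** A point with two preimages has total weight at most 1.2, but neither preimage again has two; any
    other point has weight at most 0.8. The constants satisfy 0.82 x 1.2 <= 0.985 and 0.8 <= 0.985 x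
    0.82. *)
Lemma level_small_mid (R : realType) (p : R) : 6 / 10 <= p -> p <= 7 / 10 ->
  forall eps : R, 0 < eps -> exists n, level p n.+1 (fun=> 1) < eps.
Proof.
move=> p1 p2; have p3 : p < 1 by lra.
have p4 : 2^-1 <= p by lra.
have p2' : p <= 18 / 25 by lra.
pose phi y : R := if two_preimages p y then 1 else 82 / 100.
apply: (@level_small_of_test _ _ p4 p3 phi (985 / 1000) (82 / 100)) => //.
- by apply/andP; split; lra.
- by move=> y _; rewrite /phi; case: ifP => _; apply/andP; split; lra.
move=> y hy; have /andP[y1 y2] := hy; rewrite transfer_two //; last by lra.
have phi1 z : phi z <= 1 by rewrite /phi; case: ifP => _; lra.
rewrite {3}/phi; case: ifP => hT; last first.
  rewrite add0r; case: ifP => _; last by lra.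
  by have := phi1 (cpre p y); nra.
have -> : phi (pre p y) = 82 / 100.
  rewrite /phi (negbTE (not_two_third p1 p2' _)) //.
  by apply: pre_le_third => //; rewrite /pre_weight; lra.
have -> : phi (cpre p y) = 82 / 100 by rewrite /phi (negbTE (not_two_cpre p1 p2' hy hT)).
by case: ifP => _; lra.
Qed.

(** * The range of p from 0.7 to 0.72 *)

Section HighRange.
Variables (R : realType) (p : R).
Hypothesis p_ge : 7 / 10 <= p.
Hypothesis p_le : p <= 18 / 25.

Let p_ge' : 6 / 10 <= p. Proof. by move: p_ge => ?; lra. Qed.

Ltac plra := move: p_ge p_le => ? ?; lra.

Local Notation cpre := (cpre p).
Local Notation two := (two_preimages p).
Local Notation c := ((1 - p) * (3 * p - 1)).

(** With these bounds on the powers of s, polynomial inequalities in p become linear in the powers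
    and fall to [lra]. *)
Lemma shift_base : exists s,
  [/\ p = 7 / 10 + s, 0 <= s <= 1 / 50 &
      forall k, 0 <= s ^+ k /\ s ^+ k.+1 <= s ^+ k / 50].
Proof.
exists (p - 7 / 10); split; [lra|by apply/andP; split; plra|move=> k].
have s0 : 0 <= (p - 7 / 10) ^+ k by rewrite exprn_ge0 //; plra.
by rewrite exprSr; split => //; apply: ler_wpM2l => //; plra.
Qed.

Lemma cpre_anti y z : y <= z -> z <= 2^-1 -> cpre z <= cpre y.
Proof.
move=> yz z2; move: p_ge p_le => ? ?.
rewrite !cpreE ler_pdivrMr; last by lra.
rewrite mulrAC ler_pdivlMr; last by lra.
have : 0 <= (2 * p - 1) * (z - y) by apply: mulr_ge0; lra.
by lra.
Qed.

Lemma cpre_itv y : 1 - p <= y <= 2^-1 -> 3^-1 <= cpre y <= 2^-1.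
Proof.
move=> /andP[y1 y2]; move: p_ge p_le => ? ?.
by rewrite cpreE ler_pdivlMr ?ler_pdivrMr; [apply/andP; split; lra|lra|lra].
Qed.

(* The threshold of [two_preimages] is [tau = (1 - p)(3p - 1)/p]. *)
Lemma not_two_cpre2 y : 1 - p <= y <= 2^-1 -> ~~ two y -> ~~ two (cpre (cpre y)).
Proof.
move=> hy; have /andP[y1 y2] := hy; move: p_ge p_le => ? ? hT.
have p0 : 0 < p by lra.
pose tau := c / p.
have ytau : y <= tau.
  by rewrite ler_pdivlMr // mulrC ltW // ltNge.
(* For p >= 7/10 the threshold is at most 1/2, so [cpre_anti] applies to it. *)
have [htau|htau] := lerP tau 2^-1; last first.
  exfalso; move: htau; rewrite /tau ltr_pdivlMr //; nra.
have c1 : cpre tau = (2 * p - 1) / (3 * p - 1).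
  have d0 : 0 < (3 * p - 1) * (2 * p - 1) by nra.
  by rewrite cpreE /tau; field; do ?[apply/andP; split]; lra.
have h1 : cpre tau <= cpre y by exact: cpre_anti.
have /andP[_ h2] := cpre_itv hy.
have h3 : cpre (cpre y) <= cpre (cpre tau) by exact: cpre_anti.
apply/negP => /(two_le p_ge' p_le h3); rewrite /two_preimages c1 cpreE.
have d1 : 0 < 9 * p ^+ 2 - 8 * p + 2 by nra.
have -> : (p - (2 * p - 1) / (3 * p - 1)) / (3 * p - 1 - (2 * p - 1) / (3 * p - 1))
   = (3 * p ^+ 2 - 3 * p + 1) / (9 * p ^+ 2 - 8 * p + 2).
  by field; do ?[apply/andP; split]; lra.
apply/negP; rewrite -ltNge mulrA ltr_pdivrMr //.
have [s [-> /andP[s0 s1] sk]] := shift_base.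
have [? ?] := sk 1%N; have [? ?] := sk 2%N; have [? ?] := sk 3%N; have [? ?] := sk 4%N.
by lra.
Qed.

(** The third iterate of the decreasing map [cpre] is decreasing, so it is largest at 1/3, where its
    value is still below the threshold. *)
Lemma not_two_cpre3 y : 3^-1 <= y <= 2^-1 -> ~~ two (cpre (cpre (cpre y))).
Proof.
move=> /andP[y1 y2]; move: p_ge p_le => ? ?.
have i0 : 1 - p <= y <= 2^-1 by apply/andP; split; lra.
have it : (1 - p <= (3^-1 : R)) && ((3^-1 : R) <= 2^-1) by apply/andP; split; lra.
have it2 z : 3^-1 <= z <= 2^-1 -> 1 - p <= z <= 2^-1.
  by move=> /andP[? ?]; apply/andP; split; lra.
have /andP[_ t1] := cpre_itv it; have h1 : cpre y <= cpre 3^-1 by exact: cpre_anti.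
have /it2 j1 := cpre_itv i0; have /it2 jt1 := cpre_itv it.
have h2 : cpre (cpre 3^-1) <= cpre (cpre y) by exact: cpre_anti.
have /andP[_ t2] := cpre_itv j1.
have h3 : cpre (cpre (cpre y)) <= cpre (cpre (cpre 3^-1)) by exact: cpre_anti.
apply/negP => /(two_le p_ge' p_le h3).
have e1 : cpre 3^-1 = (3 * p - 1) / (9 * p - 4) by rewrite cpreE; field; lra.
have d2 : 0 < 27 * p ^+ 2 - 24 * p + 5 by nra.
have e2 : cpre (cpre 3^-1) = (9 * p ^+ 2 - 7 * p + 1) / (27 * p ^+ 2 - 24 * p + 5).
  by rewrite e1 cpreE; field; do ?[apply/andP; split]; lra.
have d4 : 0 < 81 * p ^+ 3 - 108 * p ^+ 2 + 46 * p - 6.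
  have -> : 81 * p ^+ 3 - 108 * p ^+ 2 + 46 * p - 6 =
    (3 * p - 1) * (27 * p ^+ 2 - 24 * p + 5) - (9 * p ^+ 2 - 7 * p + 1) by ring.
  by nra.
have e3 : cpre (cpre (cpre 3^-1)) = (27 * p ^+ 3 - 33 * p ^+ 2 + 12 * p - 1) /
    (81 * p ^+ 3 - 108 * p ^+ 2 + 46 * p - 6).
  by rewrite e2 cpreE; field; do ?[apply/andP; split]; nra.
rewrite /two_preimages e3; apply/negP; rewrite -ltNge mulrA.
rewrite ltr_pdivrMr //.
have [s [-> /andP[s0 s1] sk]] := shift_base.
have [? ?] := sk 1%N; have [? ?] := sk 2%N; have [? ?] := sk 3%N; have [? ?] := sk 4%N.
by lra.
Qed.

Lemma level_small_high (eps : R) : 0 < eps -> exists n, level p n.+1 (fun=> 1) < eps.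
Proof.
move: eps; move: p_ge p_le => p1 p2.
have p3 : p < 1 by lra.
have p4 : 2^-1 <= p by lra.
(* Backward orbits of 1/2 alternate between these regions: the points with two
   preimages get the large values, and those whose next images avoid that
   region get a negligible one. *)
pose phi y : R :=
  if y < 3^-1 then 9 / 10
  else if two y then (if two (cpre (cpre y)) then 1 else 31 / 50)
  else if two (cpre y) then 53 / 100 else 1 / 100.
have phi0 y : 1 / 100 <= phi y <= 1.
  by rewrite /phi; do ![case: ifP => _]; apply/andP; split; lra.
have phi_third y : y <= 3^-1 -> phi y <= 9 / 10.
  move=> h; rewrite /phi (negbTE (not_two_third p_ge' p_le h)).
  by do ![case: ifP => _]; lra.
apply: (@level_small_of_test _ _ p4 p3 phi (49 / 50) (1 / 100)) => //.
  by apply/andP; split; lra.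
move=> y hy; have /andP[y1 y2] := hy; rewrite transfer_two //; last by lra.
have hc := cpre_itv hy; have /andP[c1 c2] := hc.
rewrite (_ : 1 - p <= cpre y = true); last by lra.
rewrite {3}/phi; case: ltP => y3.
  rewrite (negbTE (not_two_third p_ge' p_le (ltW y3))).
  by have /andP[? ?] := phi0 (cpre y); nra.
have hc3 : 1 - p <= cpre y <= 2^-1 by apply/andP; split; lra.
(* At [cpre y] the value 9/10 is excluded by cpre y >= 1/3 and the value 1 by [not_two_cpre3]. *)
have phi_c : phi (cpre y) = if two (cpre y) then 31 / 50
    else if two (cpre (cpre y)) then 53 / 100 else 1 / 100.
  rewrite /phi ltNge c1 /= (negbTE (not_two_cpre3 _)) //.
  by apply/andP; split.
case: ifP => hT.
  have h1 : phi (pre p y) <= 9 / 10.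
    by apply/phi_third/pre_le_third => //; rewrite /pre_weight; lra.
  have /andP[h0 _] := phi0 (pre p y).
  have h2 : (y + 3 * p - 2) * phi (pre p y) <= (y + 3 * p - 2) * (9 / 10).
    by apply: ler_wpM2l => //; lra.
  by rewrite phi_c (negbTE (not_two_cpre p_ge' p_le hy hT)); case: ifP => _; lra.
rewrite phi_c; case: ifP => hT1.
  by lra.
by rewrite (negbTE (not_two_cpre2 hy (negbT hT))); lra.
Qed.

End HighRange.

(** * Optimality *)

Section LimInf.
Variable R : realType.
Local Open Scope ereal_scope.

Lemma limn_einf_ge (u : (\bar R)^nat) (a : \bar R) (n0 : nat) :
  (forall n, (n0 <= n)%N -> a <= u n) -> a <= limn_einf u.
Proof.
move=> h; rewrite limn_einf_lim (cvg_lim _ (@cvg_einfs_sup _ u)) //.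
apply: (@le_trans _ _ (einfs u n0)); last by apply: ereal_sup_ubound; exists n0.
by apply: le_ereal_inf_tmp => _ [n /= hn <-]; exact: h.
Qed.

Lemma limn_einf_le (u : (\bar R)^nat) (b : \bar R) (n0 : nat) :
  (forall n, (n0 <= n)%N -> u n <= b) -> limn_einf u <= b.
Proof.
move=> h; rewrite limn_einf_lim (cvg_lim _ (@cvg_einfs_sup _ u)) //.
apply: ge_ereal_sup => _ [n _ <-].
apply: (@le_trans _ _ (u (maxn n n0))); last by apply: h; rewrite leq_maxr.
by apply: ereal_inf_lbound; exists (maxn n n0) => //=; rewrite leq_maxl.
Qed.

End LimInf.

Lemma div_nat_small (R : realType) (C eps : R) : 0 < eps ->
  exists n0 : nat, forall n, (n0 <= n)%N -> 0 < n%:R :> R /\ C / n%:R < eps.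
Proof.
move=> e0; exists (Num.bound (C / eps)).+1 => n hn.
have n0 : 0 < n%:R :> R by rewrite ltr0n (leq_trans _ hn).
split=> //; rewrite ltr_pdivrMr // mulrC -ltr_pdivrMr //.
apply: lt_le_trans (unstable.ltr_bound _) _.
by rewrite ler_nat; exact: ltnW.
Qed.

Lemma le_of_linear_growth (R : realType) (a b C : R) :
  (forall N : nat, N%:R * a <= N%:R * b + C) -> a <= b.
Proof.
move=> h; rewrite leNgt; apply/negP => ba.
have ab : 0 < a - b by rewrite subr_gt0.
have [n0 hn] := div_nat_small C ab; have [n1 n2] := hn n0 (leqnn n0).
by move: n2; rewrite ltr_pdivrMr //; have := h n0; lra.
Qed.

(** * The value as the common limit of the approximate values *)

Section Optimality.
Variables (R : realType) (p : R).
Hypothesis p_ge : 2^-1 <= p.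
Hypothesis p_lt1 : p < 1.
Hypothesis level_small : forall eps : R, 0 < eps -> exists n, level p n.+1 (fun=> 1) < eps.

Ltac plra := move: p_ge p_lt1 => ? ?; lra.

Local Notation val := (approx_value p).
Local Notation err := (approx_error p).
Local Notation K n := (kinks p n (fun=> 1)).

Let p01 : 0 <= p <= 1. Proof. by apply/andP; split; plra. Qed.

Let starP : is_ian_strategy (sigma_star p) := sigma_star_is_strategy p01.

Lemma approx_error_small (eps : R) : 0 < eps -> exists n, err n < eps.
Proof.
move=> e0; have [n hn] := level_small e0; exists n; apply: le_lt_trans hn.
rewrite /approx_error; apply: ler_piMl; first exact: level_ge0.
exact: kink_scale_le1.
Qed.

(** Let [sigma_star] play against Una's automaton of truncation [m]: both guarantees bound the same
    N-stage payoff, and the constants disappear as N grows. *)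
Lemma approx_values_cross n m : val n - err n <= val m + err m.
Proof.
apply: (@le_of_linear_growth _ _ _ (2 * K n + 2 * K m)) => N.
have := sigma_star_guarantee n p_ge p_lt1 N (una_strategyP m p_ge p_lt1).
have := una_strategy_guarantee m p_ge p_lt1 N starP.
by lra.
Qed.

Lemma sigma_star_optimal : is_optimal p (sigma_star p).
Proof.
(* The value is the supremum of the lower guarantees; by [approx_values_cross] it lies within
   [err n] of every [val n]. *)
pose A : set R := [set x | exists n, x = val n - err n]%classic.
have supA : has_sup A.
  split; first by exists (val 0 - err 0), 0.
  by exists (val 0 + err 0) => _ [n ->]; exact: approx_values_cross.
have lo n : val n - err n <= sup A by apply: ub_le_sup; [case: supA|exists n].
have up n : sup A <= val n + err n.
  by apply: ge_sup; [case: supA|move=> _ [m ->]; exact: approx_values_cross].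
have guarantee (eps : R) : 0 < eps -> exists n0 : nat, forall N, (n0 <= N)%N ->
    forall tau, is_una_strategy tau -> sup A - eps < gamma p N (sigma_star p) tau.
  move=> e0; have e4 : 0 < eps / 4 by lra.
  have [n hn] := approx_error_small e4.
  have [n0 h0] := div_nat_small (2 * K n) e4; exists n0 => N /h0[N0 hN] tau tauP.
  rewrite gammaE ltr_pdivlMr //.
  have := sigma_star_guarantee n p_ge p_lt1 N tauP.
  move: hN; rewrite ltr_pdivrMr // => hN.
  have : (sup A - eps / 2) * N%:R <= (val n - err n) * N%:R.
    by apply: ler_wpM2r; [exact: ltW|have := up n; lra].
  have : 0 < eps / 4 * N%:R by rewrite mulr_gt0.
  by lra.
split; first exact: starP.
exists (sup A); split; last first.
  move=> tau tauP; apply/lee_subgt0Pr => eps e0.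
  have [n0 h0] := guarantee _ e0; apply: (@limn_einf_ge _ _ _ n0) => n hn.
  by rewrite -EFinB lee_fin ltW //; exact: h0.
move=> eps e0; have [n0 h0] := guarantee _ e0.
have e4 : 0 < eps / 4 by lra.
have [n hn] := approx_error_small e4.
have [n1 h1] := div_nat_small (2 * K n) e4.
exists (maxn n0 n1), (sigma_star p), (una_strategy p n).
split=> [||N]; [exact: starP|exact: una_strategyP|].
rewrite geq_max => /andP[N0 /h1[Npos hN]]; split=> [tau tauP|sigma sigmaP]; first exact: h0.
rewrite gammaE ltr_pdivrMr //.
have := una_strategy_guarantee n p_ge p_lt1 N sigmaP.
move: hN; rewrite ltr_pdivrMr // => hN.
have : (val n + err n) * N%:R <= (sup A + eps / 2) * N%:R.
  by apply: ler_wpM2r; [exact: ltW|have := lo n; lra].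
have : 0 < eps / 4 * N%:R by rewrite mulr_gt0.
by lra.
Qed.

End Optimality.

(** * Deviation near belief 1/2 *)

Section Deviation.
Variables (R : realType) (p e al : R).
Hypothesis p_ge : 2^-1 <= p.
Hypothesis p_lt1 : p < 1.
Hypothesis al0 : 0 <= al.
Hypothesis al_lt : al < e.
Hypothesis e_le : e <= 2^-1.

Ltac plra := move: p_ge p_lt1 al0 al_lt e_le => ? ? ? ? ?; lra.

(** When the folded belief exceeds [e], Ian splits the belief into the posteriors [al] and [1 - al],
    playing 1 with total probability (theta - al)/(1 - 2 al). *)
Definition dev_act (theta : R) : R * R :=
  if e < fold_belief theta then
    (al * ((theta - al) / (1 - 2 * al)) / (1 - theta),
     (1 - al) * ((theta - al) / (1 - 2 * al)) / theta)
  else star_act theta.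

Definition dev_next (theta : R) (i : bool) : R :=
  if e < fold_belief theta then
    (if i then p - (2 * p - 1) * al else 1 - p + (2 * p - 1) * al)
  else belief_step p theta i.

Definition dev_target : R := 1 - p + (2 * p - 1) * al.
(** The payoff of the split at folded belief [x] against Una's better reply. *)
Definition dev_payoff (x : R) : R := (1 - al) * ((x - al) / (1 - 2 * al)).

Lemma dev_target_folded : folded p dev_target.
Proof.
rewrite /folded /dev_target; move: p_ge p_lt1 al0 al_lt e_le => ? ? ? ? ?.
by apply/andP; split; nra.
Qed.

Lemma fold_gt theta : e < fold_belief theta -> e < theta < 1 - e.
Proof.
have [h|/ltW h] := leP theta 2^-1.
  by rewrite fold_belief_low // => ?; apply/andP; split; plra.
by rewrite fold_belief_high // => ?; apply/andP; split; plra.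
Qed.

Lemma dev_dom_step theta i : belief_dom p theta -> belief_dom p (dev_next theta i).
Proof.
move=> Dt; rewrite /dev_next; case: ifP => _; last exact: belief_dom_step.
have /andP[h1 h2] := dev_target_folded; rewrite /dev_target in h1 h2.
by case: i; apply/andP; split; plra.
Qed.

Lemma star_act01 theta : belief_dom p theta ->
  (0 <= (star_act theta).1 <= 1) /\ (0 <= (star_act theta).2 <= 1).
Proof.
move=> /andP[h1 h2]; rewrite /star_act; move: p_ge p_lt1 => ? ?.
have [h|h] := leP theta 2^-1; split; rewrite /= ?lexx ?ler01 //.
  by rewrite divr_ge0 ?ler_pdivrMr; lra.
by rewrite divr_ge0 ?ler_pdivrMr; lra.
Qed.

Lemma dev_act01 theta : belief_dom p theta ->
  (0 <= (dev_act theta).1 <= 1) /\ (0 <= (dev_act theta).2 <= 1).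
Proof.
move=> Dt; rewrite /dev_act; case: ifP => [/fold_gt/andP[h1 h2]|_]; last exact: star_act01.
move: p_ge p_lt1 al0 al_lt e_le => ? ? ? ? ?.
have a2 : 0 < 1 - 2 * al by lra.
have k0 : 0 <= (theta - al) / (1 - 2 * al) by apply: divr_ge0; lra.
have k1 : (theta - al) / (1 - 2 * al) * (1 - 2 * al) = theta - al by rewrite divfK ?gt_eqF.
move: k0 k1; set k := (theta - al) / _ => k0 k1.
by split; rewrite /= divr_ge0 ?ler_pdivrMr; nra.
Qed.

Lemma dev_strategyP : is_ian_strategy (belief_strategy dev_act dev_next).
Proof.
by move=> h; apply/dev_act01/(belief_afterD (belief_dom_half p_ge p_lt1) dev_dom_step).
Qed.

Lemma dev_move_prob theta i : e < fold_belief theta -> move_prob dev_act theta i =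
  if i then (theta - al) / (1 - 2 * al) else 1 - (theta - al) / (1 - 2 * al).
Proof.
move=> h; have /andP[h1 h2] := fold_gt h; rewrite /move_prob /dev_act h.
by case: i => /=; field; do ?[apply/andP; split]; plra.
Qed.

Lemma dev_bayes theta i : belief_dom p theta ->
  move_prob dev_act theta i * dev_next theta i =
  (1 - p) * ((1 - theta) * bernoulli_weight (dev_act theta).1 i)
  + p * (theta * bernoulli_weight (dev_act theta).2 i).
Proof.
move=> Dt; case: (boolP (e < fold_belief theta)) => h; last first.
  rewrite /move_prob /dev_act /dev_next (negbTE h).
  exact: (star_bayes p_ge p_lt1 i Dt).
rewrite dev_move_prob //; have /andP[h1 h2] := fold_gt h.
rewrite /dev_act /dev_next h.
by case: i => /=; field; do ?[apply/andP; split]; plra.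
Qed.

Lemma dev_mean_payoff theta u : e < fold_belief theta ->
  dev_payoff (fold_belief theta) <= mean_payoff dev_act theta u.
Proof.
move=> h; have /andP[h1 h2] := fold_gt h; rewrite /mean_payoff /dev_act h /dev_payoff.
have a2 : 0 < 1 - 2 * al by plra.
have key x : x <= theta -> (1 - al) * ((x - al) / (1 - 2 * al)) <=
    (1 - al) * ((theta - al) / (1 - 2 * al)).
  move=> hx; apply: ler_wpM2l; first by plra.
  by rewrite ler_pM2r ?invr_gt0 //; lra.
have key' x : x <= 1 - theta -> (1 - al) * ((x - al) / (1 - 2 * al)) <=
    (1 - al) * ((1 - theta - al) / (1 - 2 * al)).
  move=> hx; apply: ler_wpM2l; first by plra.
  by rewrite ler_pM2r ?invr_gt0 //; lra.
case: u => /=.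
  rewrite [X in _ <= X]mulrC divfK; last by plra.
  by apply: key; rewrite /fold_belief ge_min lexx.
rewrite (_ : (1 - theta) * _ = (1 - al) * ((1 - theta - al) / (1 - 2 * al))).
  by apply: key'; rewrite /fold_belief ge_min lexx orbT.
by field; do ?[apply/andP; split]; plra.
Qed.

Lemma dev_bound (v C : R) (w : R -> R) tau N : is_una_strategy tau ->
  (forall x, folded p x -> `|w x| <= C) ->
  (forall x, folded p x -> v + w x <=
     if e < x then dev_payoff x + w dev_target
     else x + (x * w (1 - p) + (1 - x) * w (fold_belief (upd p x)))) ->
  N%:R * v - 2 * C <=
    expect p (belief_strategy dev_act dev_next) tau N (total_payoff R).
Proof.
move=> tauP wC wE.
have p01 : 0 <= p <= 1 by apply/andP; split; plra.
have HW theta u : belief_dom p theta -> v + w (fold_belief theta) <=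
    1 * mean_payoff dev_act theta u +
    \sum_(i : bool) move_prob dev_act theta i * w (fold_belief (dev_next theta i)).
  move=> Dt; have /wE := folded_fold Dt; rewrite mul1r.
  case: ifP => h E.
    apply: (le_trans E); apply: lerD; first exact: dev_mean_payoff.
    rewrite big_bool /= !dev_move_prob // /dev_next h.
    have /andP[_ t2] := dev_target_folded.
    rewrite -(fold_beliefC (p - _)) (_ : 1 - (p - (2 * p - 1) * al) = dev_target); last first.
      by rewrite /dev_target; ring.
    rewrite -/dev_target fold_belief_low //.
    by rewrite -mulrDl subrKC mul1r.
  have -> : mean_payoff dev_act theta u = mean_payoff (@star_act R) theta u.
    by rewrite /mean_payoff /dev_act h.
  rewrite (eq_bigr (fun i => move_prob (@star_act R) theta i *
    w (fold_belief (belief_step p theta i)))); last first.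
    by move=> i _; rewrite /move_prob /dev_act /dev_next h.
  by rewrite (star_mean_payoff p_ge p_lt1 _ Dt) (star_step p_ge p_lt1 w Dt).
have half := belief_dom_half p_ge p_lt1.
have := expect_belief_potential p01 dev_strategyP half dev_dom_step dev_bayes
  tauP N (W := w \o @fold_belief R) HW.
rewrite expectD expectZ /= mul1r.
have : `|w (fold_belief 2^-1)| <= C by apply/wC/folded_fold.
rewrite ler_norml => /andP[w0 _].
set E := expect p _ tau N (fun h => w _).
have : E <= C.
  rewrite -(expect_cst p (belief_strategy dev_act dev_next) tau N C).
  apply: expect_le => // [|h]; first exact: dev_strategyP.
  have : `|w (fold_belief (belief_after dev_next [seq ian_move x | x <- h]))| <= C.
    by apply/wC/folded_fold/(belief_afterD half dev_dom_step).
  by rewrite ler_norml => /andP[].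
by lra.
Qed.

End Deviation.

(** * Potentials truncated at a finite horizon *)

Section TruncatedPotential.
Variables (R : realType) (p e al v w0 : R).
Hypothesis p_ge : 2^-1 <= p.
Hypothesis p_lt1 : p < 1.
Hypothesis al0 : 0 <= al.
Hypothesis al_lt : al < e.
Hypothesis e_le : e <= 2^-1.

Ltac plra := move: p_ge p_lt1 al0 al_lt e_le => ? ? ? ? ?; lra.

(* The truncated potential at the folded belief [Y / (X + Y)], multiplied by
   [X + Y]: in this form no division occurs along an orbit. *)
Fixpoint cone_value (j : nat) (X Y : R) : R :=
  if j is j'.+1 then
    if e * (X + Y) < Y then
      (1 - al) * ((Y - al * (X + Y)) / (1 - 2 * al)) - v * (X + Y)
      + cone_value j' ((X + Y) * (1 - dev_target p al)) ((X + Y) * dev_target p al)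
    else
      let a := p * (X - Y) + (1 - p) * Y in
      let b := (1 - p) * (X - Y) + p * Y in
      Y - v * (X + Y) + cone_value j' (Num.max a b) (Num.min a b)
  else w0 * (X + Y).

Lemma cone_valueZ j t X Y : 0 < t -> cone_value j (t * X) (t * Y) = t * cone_value j X Y.
Proof.
move=> t0; elim: j X Y => [|j IH] X Y /=; first by ring.
rewrite (_ : e * (t * X + t * Y) = t * (e * (X + Y))) ?ltr_pM2l //; last by ring.
case: ifP => _.
  rewrite -!mulrDr -!mulrA IH !mulrDr; congr (_ + _); ring.
have -> c : c * (t * X - t * Y) + (1 - c) * (t * Y) = t * (c * (X - Y) + (1 - c) * Y).
  by ring.
have -> : (1 - p) * (t * X - t * Y) + p * (t * Y) = t * ((1 - p) * (X - Y) + p * Y).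
  by ring.
rewrite -maxr_pMr -?minr_pMr ?ltW // IH !mulrDr; congr (_ + _); ring.
Qed.

(** The restart at 1 - p is given the value 0, so its term is absent from the recursion; the sign of
    the potential at 1 - p then tells whether [v] is a lower or an upper bound. *)
Definition potential (j : nat) (x : R) : R := cone_value j (1 - x) x.

Lemma potentialS j x : folded p x -> potential j.+1 x =
  if e < x then dev_payoff al x - v + potential j (dev_target p al)
  else x - v + (1 - x) * potential j (fold_belief (upd p x)).
Proof.
move=> hx; rewrite /potential /= subrK !mulr1.
case: ifP => _; first by rewrite !mul1r.
have x0 : 0 < 1 - x by case/andP: hx => ? ?; lra.
rewrite -cone_valueZ //.
have ef : (1 - x) * fold_belief (upd p x) =
    Num.min (p * (1 - x - x) + (1 - p) * x) ((1 - p) * (1 - x - x) + p * x).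
  rewrite /fold_belief minr_pMr ?ltW // minC.
  by rewrite [X in Num.min X _]mulrBr updP //; congr Num.min; ring.
congr (_ + cone_value _ _ _) => //; rewrite [in RHS]mulrBr [in RHS]mulr1 ef.
by apply/(addrI _)/etrans; [exact: addr_min_max|rewrite [RHS]addrC subrK; ring].
Qed.

Lemma potential_bounded j : exists C, forall x, folded p x -> `|potential j x| <= C.
Proof.
have tf := dev_target_folded p_ge p_lt1 al0 al_lt e_le.
elim: j => [|j [C IH]].
  by exists `|w0| => x _; rewrite /potential /= subrK mulr1.
exists ((1 - al) / (1 - 2 * al) + 1 + `|v| + C) => x hx.
have [x1 x2] := andP hx.
have a2 : 0 < (1 - 2 * al)^-1 by rewrite invr_gt0; plra.
have a3 : 0 <= (1 - al) * (1 - 2 * al)^-1 by apply: mulr_ge0; [plra|exact: ltW].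
rewrite potentialS //; case: ifP => h.
  apply: (le_trans (ler_normD _ _)); apply: lerD; last exact: IH.
  apply: (le_trans (ler_normB _ _)); apply: lerD => //.
  rewrite ger0_norm /dev_payoff.
    apply: (@le_trans _ _ ((1 - al) / (1 - 2 * al))); last by rewrite lerDl.
    apply: ler_wpM2l; first by plra.
    by rewrite ler_piMl ?ltW //; plra.
  by apply: mulr_ge0; [plra|apply: mulr_ge0; [plra|exact: ltW]].
apply: (le_trans (ler_normD _ _)); apply: lerD.
  apply: (le_trans (ler_normB _ _)); apply: lerD => //.
  by rewrite ger0_norm; plra.
have hf := folded_fold (upd_itv p_ge p_lt1 hx).
rewrite normrM -[C]mul1r; apply: ler_pM => //; last exact: IH.
by rewrite ger0_norm; plra.
Qed.

Lemma potential_incr j : (forall x, folded p x -> potential 0 x <= potential 1 x) ->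
  forall x, folded p x -> potential j x <= potential j.+1 x.
Proof.
have tf := dev_target_folded p_ge p_lt1 al0 al_lt e_le.
move=> h0; elim: j => // j IH x hx; rewrite potentialS // [leRHS]potentialS //.
case: ifP => _; rewrite lerD2l; first exact: IH.
have [x1 x2] := andP hx; apply: ler_wpM2l; first by lra.
exact/IH/folded_fold/upd_itv.
Qed.

Lemma potential_decr j : (forall x, folded p x -> potential 1 x <= potential 0 x) ->
  forall x, folded p x -> potential j.+1 x <= potential j x.
Proof.
have tf := dev_target_folded p_ge p_lt1 al0 al_lt e_le.
move=> h0; elim: j => // j IH x hx; rewrite potentialS // [leRHS]potentialS //.
case: ifP => _; rewrite lerD2l; first exact: IH.
have [x1 x2] := andP hx; apply: ler_wpM2l; first by lra.
exact/IH/folded_fold/upd_itv.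
Qed.

End TruncatedPotential.

(** Started at -1, the potential increases with the horizon, thanks to the two bounds on [v]. Hence
    horizon j is at most one evaluation step of itself, and the omitted restart term is
    nonnegative. *)
Lemma dev_guarantee (R : realType) (p e al v w0 : R) j : w0 = -1 ->
  2^-1 <= p -> p < 1 -> 0 <= al -> al < e -> e <= 2^-1 ->
  v <= (1 - p) * 2 -> v <= dev_payoff al e ->
  0 <= cone_value p e al v w0 j p (1 - p) ->
  exists C, forall tau N, is_una_strategy tau ->
  N%:R * v - C <= expect p (belief_strategy (dev_act e al) (dev_next p e al)) tau N
     (total_payoff R).
Proof.
move=> -> p_ge p_lt1 a0 ae e2 vp ve hq.
have [C hC] := potential_bounded v (-1) p_ge p_lt1 a0 ae e2 j.
exists (2 * C) => tau N tauP.
apply: (dev_bound p_ge p_lt1 a0 ae e2 (w := potential p e al v (-1) j) N tauP hC) => x hx.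
have [x1 x2] := andP hx.
have incr : forall x, folded p x -> potential p e al v (-1) 0 x <= potential p e al v (-1) 1 x.
  move=> y hy; have [y1 y2] := andP hy.
  rewrite potentialS // /potential /= !subrK !mulr1; case: ifP => h; last by nra.
  have : dev_payoff al e <= dev_payoff al y.
    apply: ler_wpM2l; first by lra.
    by apply: ler_wpM2r; [rewrite invr_ge0; lra|lra].
  by lra.
have := potential_incr p_ge p_lt1 a0 ae e2 j incr hx.
rewrite potentialS //; case: ifP => _; first by lra.
have : 0 <= x * potential p e al v (-1) j (1 - p).
  by apply: mulr_ge0; [lra|rewrite /potential subKr].
by lra.
Qed.

(** With e = 1/2 no folded belief triggers the split, so the recursion is that of [sigma_star].
    Started at 1 the potential decreases, and its negative is used with k = -1. *)
Lemma star_upper (R : realType) (p e al v w0 : R) j : e = 2^-1 -> al = 0 -> w0 = 1 ->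
  2^-1 <= p -> p < 1 -> 0 <= v ->
  cone_value p e al v w0 j p (1 - p) <= 0 ->
  exists C, forall tau N, is_una_strategy tau ->
  expect p (sigma_star p) tau N (total_payoff R) <= N%:R * v + C.
Proof.
move=> -> -> -> p_ge p_lt1 v0 hq.
have a0 : (0 : R) <= 0 by [].
have ae : (0 : R) < 2^-1 by rewrite invr_gt0 ltr0n.
have e2 : (2^-1 : R) <= 2^-1 by [].
have [C hC] := potential_bounded v 1 p_ge p_lt1 a0 ae e2 j.
exists (2 * C) => tau N tauP.
pose w x := - potential p 2^-1 0 v 1 j x.
have step i y : folded p y -> potential p 2^-1 0 v 1 i.+1 y =
    y - v + (1 - y) * potential p 2^-1 0 v 1 i (fold_belief (upd p y)).
  by move=> hy; rewrite potentialS //; case/andP: hy => _; rewrite leNgt => /negbTE ->.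
have wC x : folded p x -> `|w x| <= C by move=> hx; rewrite normrN; exact: hC.
have := @sigma_star_bound _ _ p_ge p_lt1 (-1) (- v) C w tau N tauP wC.
rewrite mulN1r => H.
have /H : forall x, folded p x -> - v + w x <=
    -1 * x + (x * w (1 - p) + (1 - x) * w (fold_belief (upd p x))); last by lra.
move=> x hx; have [x1 x2] := andP hx; rewrite /w.
have decr : forall x, folded p x ->
    potential p 2^-1 0 v 1 1 x <= potential p 2^-1 0 v 1 0 x.
  move=> y hy; have [y1 y2] := andP hy.
  by rewrite step // /potential /= !subrK; lra.
have := potential_decr p_ge p_lt1 a0 ae e2 j decr hx.
rewrite step //.
have : x * potential p 2^-1 0 v 1 j (1 - p) <= 0.
  by apply: mulr_ge0_le0; [lra|rewrite /potential subKr].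
by lra.
Qed.

(** * Exact evaluation *)

Section IntegerEvaluation.
Variable R : realType.

(** Binary integers make the exact evaluation computable; [zr] embeds them into [R]. *)
Definition zr (z : Z) : R := (int_of_Z z)%:~R.
Arguments zr z%_Z_scope.

Lemma zrD a b : zr (Z.add a b) = zr a + zr b.
Proof. by rewrite /zr -rmorphD -raddfD. Qed.

Lemma zrN a : zr (Z.opp a) = - zr a.
Proof. by rewrite /zr -rmorphN -raddfN. Qed.

Lemma zrB a b : zr (Z.sub a b) = zr a - zr b.
Proof. by rewrite -Z.add_opp_r zrD zrN. Qed.

Lemma zrM a b : zr (Z.mul a b) = zr a * zr b.
Proof. by rewrite /zr -rmorphM -rmorphM. Qed.

Lemma zr_ge0 a : Z.leb 0 a -> 0 <= zr a.
Proof. by case: a => // a _; rewrite /zr /= ler0z. Qed.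

Lemma zr_gt0 a : Z.ltb 0 a -> 0 < zr a.
Proof.
by case: a => // a _; rewrite /zr /= ltr0z; have := Pos2Nat.is_pos a; case: Pos.to_nat => [/PeanoNat.Nat.nlt_0_r|].
Qed.

Lemma zr_le a b : (zr a <= zr b) = Z.leb a b.
Proof.
apply/idP/idP; last first.
  by move=> h; rewrite -subr_ge0 -zrB zr_ge0 //; lia.
move=> h; rewrite leNgt in h; apply/negbNE/negP => h'.
by move/negP: h; apply; rewrite -subr_gt0 -zrB zr_gt0 //; lia.
Qed.

Lemma zr_lt a b : (zr a < zr b) = Z.ltb a b.
Proof. by rewrite ltNge zr_le; apply/idP/idP; lia. Qed.

Lemma zr_nat n : zr (Z.of_nat n) = n%:R.
Proof. by case: n => // n; rewrite /zr /= SuccNat2Pos.id_succ. Qed.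

End IntegerEvaluation.

Arguments zr R z%_Z_scope.

(* [cone_value] for p = P/Q, e = en/ed, al = an/ad, v = vn/vd, with all
   denominators cleared. *)
Section IntegerCone.
Variables P Q en ed an ad vn vd w0 : Z.
Local Open Scope Z_scope.

Fixpoint integer_cone (j : nat) (acc X Y : Z) : Z :=
  if j is S j' then
    let m := X + Y in
    if en * m <? ed * Y then
      integer_cone j'
        (Q * ad * (acc + ((ad - an) * (ad * Y - an * m) * vd - vn * m * ((ad - 2 * an) * ad))))
        (m * (P * ad - (2 * P - Q) * an))
        (m * ((Q - P) * ad + (2 * P - Q) * an))
    else
      let a := ad * (P * (X - Y) + (Q - P) * Y) in
      let b := ad * ((Q - P) * (X - Y) + P * Y) in
      let acc' := Q * ad * (acc + (Y * vd - vn * m) * ((ad - 2 * an) * ad)) in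
      if a <=? b then integer_cone j' acc' b a else integer_cone j' acc' a b
  else acc + vd * ((ad - 2 * an) * ad) * (w0 * (X + Y)).

End IntegerCone.

#[local] Arguments Z.add : simpl never.
#[local] Arguments Z.sub : simpl never.
#[local] Arguments Z.mul : simpl never.
#[local] Arguments Z.pow : simpl never.
#[local] Arguments Z.of_nat : simpl never.

Section IntegerConeCorrect.
Variable R : realType.
Variables P Q en ed an ad vn vd w0 : Z.
Local Notation zr := (@zr R).
Hypothesis Q0 : 0 < zr Q.
Hypothesis ed0 : 0 < zr ed.
Hypothesis ad0 : 0 < zr ad.
Hypothesis an2 : 0 < zr (Z.sub ad (Z.mul 2 an)).
Hypothesis vd0 : 0 < zr vd.

Let zrE := (zrD, zrB, zrM).

Lemma zr2 : zr (Z.pos (xO xH)) = 2. Proof. by []. Qed.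

(** Each step multiplies the point and the accumulated payoff by [Q * ad], which the homogeneity of
    [cone_value] absorbs. *)
Lemma integer_coneE j acc X Y :
  zr (integer_cone P Q en ed an ad vn vd w0 j acc X Y) =
  (zr Q * zr ad) ^+ j * (zr acc + zr vd * ((zr ad - 2 * zr an) * zr ad) *
  cone_value (zr P / zr Q) (zr en / zr ed) (zr an / zr ad) (zr vn / zr vd) (zr w0)
    j (zr X) (zr Y)).
Proof.
have a2 : 0 < zr ad - 2 * zr an by move: an2; rewrite !zrE zr2.
have n0 : [/\ zr Q != 0, zr ed != 0, zr ad != 0, zr vd != 0 & zr ad - 2 * zr an != 0].
  by split; rewrite gt_eqF.
case: n0 => nQ ne na nv n2.
elim: j acc X Y => [|j IH] acc X Y.
  by rewrite /= !zrE zr2 expr0 mul1r.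
have near : (zr en / zr ed * (zr X + zr Y) < zr Y) = Z.ltb (Z.mul en (Z.add X Y)) (Z.mul ed Y).
  by rewrite -(zr_lt R) !zrE mulrAC ltr_pdivrMr // [zr Y * _]mulrC.
rewrite /= near.
have qa0 : 0 < zr Q * zr ad by rewrite mulr_gt0.
have scale (X' Y' : R) : zr Q * zr ad * cone_value (zr P / zr Q) (zr en / zr ed)
   (zr an / zr ad) (zr vn / zr vd) (zr w0) j X' Y' =
   cone_value (zr P / zr Q) (zr en / zr ed)
   (zr an / zr ad) (zr vn / zr vd) (zr w0) j (zr Q * zr ad * X') (zr Q * zr ad * Y').
  by rewrite cone_valueZ.
case: ifP => _.
  rewrite IH exprSr -[RHS]mulrA; congr (_ * _).
  rewrite (_ : zr (Z.mul (Z.add X Y) (Z.sub _ _)) =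
    zr Q * zr ad * ((zr X + zr Y) * (1 - dev_target (zr P / zr Q) (zr an / zr ad)))); last first.
    by rewrite !zrE zr2 /dev_target; field; rewrite nQ na.
  rewrite (_ : zr (Z.mul (Z.add X Y) (Z.add _ _)) =
    zr Q * zr ad * ((zr X + zr Y) * dev_target (zr P / zr Q) (zr an / zr ad))); last first.
    by rewrite !zrE zr2 /dev_target; field; rewrite nQ na.
  rewrite -scale; set c := cone_value _ _ _ _ _ _ _ _.
  by rewrite !zrE zr2; field; rewrite nv na n2.
set a := Z.mul ad (Z.add (Z.mul P (Z.sub X Y)) _).
set b := Z.mul ad (Z.add (Z.mul (Z.sub Q P) _) _).
have ea : zr Q * zr ad * (zr P / zr Q * (zr X - zr Y) + (1 - zr P / zr Q) * zr Y) = zr a.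
  by rewrite /a !zrE; field.
have eb : zr Q * zr ad * ((1 - zr P / zr Q) * (zr X - zr Y) + zr P / zr Q * zr Y) = zr b.
  by rewrite /b !zrE; field.
set acc' := Z.mul (Z.mul Q ad) _.
have -> : zr (if Z.leb a b then integer_cone P Q en ed an ad vn vd w0 j acc' b a
              else integer_cone P Q en ed an ad vn vd w0 j acc' a b) =
  (zr Q * zr ad) ^+ j * (zr acc' + zr vd * ((zr ad - 2 * zr an) * zr ad) *
  cone_value (zr P / zr Q) (zr en / zr ed) (zr an / zr ad) (zr vn / zr vd) (zr w0)
    j (Num.max (zr a) (zr b)) (Num.min (zr a) (zr b))).
  have := zr_le R a b; case: Z.leb => h; rewrite IH.
    by rewrite max_r // min_l.
  by rewrite max_l ?min_r //; apply: ltW; rewrite ltNge h.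
rewrite exprSr -[RHS]mulrA; congr (_ * _).
rewrite -ea -eb -maxr_pMr ?ltW // -minr_pMr ?ltW // -scale /acc'.
set c := cone_value _ _ _ _ _ _ _ _.
by rewrite !zrE zr2; field.
Qed.

End IntegerConeCorrect.

(** Optimality would force the value below about [v1], whereas Una's near-optimal strategy, faced
    with [sigma], forces it above about [v2]. *)
Lemma not_optimal_of_better (R : realType) (p v1 v2 C1 C2 : R) (sigma : ian_fun R) :
  0 <= p <= 1 -> is_ian_strategy sigma -> v1 < v2 ->
  (forall tau N, is_una_strategy tau ->
     expect p (sigma_star p) tau N (total_payoff R) <= N%:R * v1 + C1) ->
  (forall tau N, is_una_strategy tau ->
     N%:R * v2 - C2 <= expect p sigma tau N (total_payoff R)) ->
  ~ is_optimal p (sigma_star p).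
Proof.
move=> p01 sigmaP v12 up lo [_ [v [vP vopt]]].
have d0 : 0 < (v2 - v1) / 4 by rewrite divr_gt0 ?subr_gt0 // ltr0n.
set d := (v2 - v1) / 4 in d0; have dE : v2 = v1 + 4 * d by rewrite /d; field.
have v_le : v <= v1 + d.
  (* Any strategy of Una serves here, since the upper bound holds against all of them. *)
  have tauP : is_una_strategy (fun=> 0 : R) by move=> h; rewrite lexx ler01.
  have [n0 hn] := div_nat_small C1 d0.
  rewrite -lee_fin; apply: le_trans (vopt _ tauP) _.
  apply: (@limn_einf_le _ _ _ n0) => n /hn[npos hC].
  rewrite lee_fin gammaE ler_pdivrMr //; have := up _ n tauP.
  by move: hC; rewrite ltr_pdivrMr //; lra.
have [n0 [sigma' [tau [_ tauP vN]]]] := vP _ d0.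
have [n1 hn] := div_nat_small C2 d0.
have [npos hC] := hn (maxn n0 n1) (leq_maxr _ _).
have [_ /(_ _ sigmaP)] := vN (maxn n0 n1) (leq_maxl _ _).
rewrite gammaE ltr_pdivrMr //; have := lo _ (maxn n0 n1) tauP.
move: hC; rewrite ltr_pdivrMr // => hC h1 h2.
have h3 : v * (maxn n0 n1)%:R <= (v1 + d) * (maxn n0 n1)%:R := ler_wpM2r (ltW npos) v_le.
have : 0 < d * (maxn n0 n1)%:R by rewrite mulr_gt0.
by move: h1 h2 h3 hC; rewrite dE; lra.
Qed.

(** * The explicit counterexample *)

Section Counterexample.
Variable R : realType.
#[local] Opaque zr.
Local Notation zr := (@zr R).

Lemma zr_frac_le a b c d : Z.ltb 0 b -> Z.ltb 0 d -> Z.leb (Z.mul a d) (Z.mul c b) ->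
  zr a / zr b <= zr c / zr d.
Proof.
move=> /(zr_gt0 R) b0 /(zr_gt0 R) d0 h.
by rewrite ler_pdivrMr // mulrAC ler_pdivlMr // -!zrM zr_le.
Qed.

Lemma zr_frac_lt a b c d : Z.ltb 0 b -> Z.ltb 0 d -> Z.ltb (Z.mul a d) (Z.mul c b) ->
  zr a / zr b < zr c / zr d.
Proof.
move=> /(zr_gt0 R) b0 /(zr_gt0 R) d0 h.
by rewrite ltr_pdivrMr // mulrAC ltr_pdivlMr // -!zrM zr_lt.
Qed.

Lemma cone_value_start P Q en ed an ad vn vd w0 j :
  Z.ltb 0 Q -> Z.ltb 0 ed -> Z.ltb 0 ad -> Z.ltb 0 (Z.sub ad (Z.mul 2 an)) -> Z.ltb 0 vd ->
  let c := cone_value (zr P / zr Q) (zr en / zr ed) (zr an / zr ad) (zr vn / zr vd) (zr w0) j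
    (zr P / zr Q) (1 - zr P / zr Q) in
  let z := integer_cone P Q en ed an ad vn vd w0 j 0 P (Z.sub Q P) in
  (Z.leb 0 z -> 0 <= c) /\ (Z.leb z 0 -> c <= 0).
Proof.
move=> /(zr_gt0 R) Q0 /(zr_gt0 R) ed0 /(zr_gt0 R) ad0 /(zr_gt0 R) an2 /(zr_gt0 R) vd0 c z.
have an2' : 0 < zr ad - 2 * zr an by move: an2; rewrite zrB zrM zr2.
have k0 : 0 < (zr Q * zr ad) ^+ j * (zr vd * ((zr ad - 2 * zr an) * zr ad) * zr Q).
  by rewrite !mulr_gt0 // exprn_gt0 // mulr_gt0.
have e : zr z = (zr Q * zr ad) ^+ j * (zr vd * ((zr ad - 2 * zr an) * zr ad) * zr Q) * c.
  rewrite /z integer_coneE // (zr_nat R 0) add0r -!mulrA; congr (_ * (_ * (_ * (_ * _)))).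
  rewrite /c -cone_valueZ //.
  rewrite (_ : zr Q * (zr P / zr Q) = zr P); last by field; rewrite gt_eqF.
  by rewrite (_ : zr Q * (1 - _) = zr (Z.sub Q P)) // zrB; field; rewrite gt_eqF.
by split; rewrite -(zr_le R) e (zr_nat R 0) ?pmulr_rge0 ?pmulr_rle0.
Qed.

(* At a number close to [ce_num / ce_den] the belief orbit of [1 - p] under
   [sigma_star] hits 1/2 after 21 stages, so that the deviation at 1/2 is used
   with a positive frequency; the gain is about 3.5e-13 per stage. *)
Definition ce_num : Z := 32734.
Definition ce_den : Z := 44667.

(** Here e = 1/2, al = 0, the starting value is 1 and the horizon 60; the sign shows that
    [sigma_star] averages at most 999165/2764546. *)
Lemma star_certificate : Z.leb (integer_cone ce_num ce_den 1 2 0 1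
  999165 2764546 1 60 0 ce_num (Z.sub ce_den ce_num)) 0.
Proof. by vm_compute. Qed.

(** Here e = 499/1000, just below 1/2, and al = 1/2500. The bound 742036/2053107 is a Farey
    neighbour of the previous one and exceeds it by about 1.8e-13. *)
Lemma dev_certificate : Z.leb 0 (integer_cone ce_num ce_den 499 1000 1 2500
  742036 2053107 (-1) 60 0 ce_num (Z.sub ce_den ce_num)).
Proof. by vm_compute. Qed.

Lemma small_bounds (v p al e : R) : v <= 2 / 5 -> p <= 3 / 4 -> 0 <= al -> al <= 1 / 100 ->
  49 / 100 <= e -> v <= (1 - p) * 2 /\ v <= dev_payoff al e.
Proof.
move=> *; split; first by lra.
by rewrite /dev_payoff mulrA ler_pdivlMr; nra.
Qed.

Lemma sigma_star_not_optimal :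
  exists p : R, 2^-1 <= p < 733 / 1000 /\ ~ is_optimal p (sigma_star p).
Proof.
pose p := zr ce_num / zr ce_den; exists p.
have half : 2^-1 = zr 1 / zr 2 by rewrite zr2 div1r.
have p_ge : 2^-1 <= p by rewrite half; exact: zr_frac_le.
have p_lt : p < 733 / 1000.
  by rewrite -(zr_nat R 733) -(zr_nat R 1000); exact: zr_frac_lt.
have p_lt1 : p < 1 by rewrite /p -[1](divr1 1); exact: (@zr_frac_lt _ _ 1 1).
split; first by rewrite p_ge p_lt.
have v0 : 0 <= zr 999165 / zr 2764546 by apply: divr_ge0; exact: zr_ge0.
have [_ star_le] := @cone_value_start ce_num ce_den 1 2 0 1 999165 2764546 1 60
  isT isT isT isT isT.
have [dev_ge _] := @cone_value_start ce_num ce_den 499 1000 1 2500 742036 2053107 (-1) 60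
  isT isT isT isT isT.
have zr0 : zr 0 / zr 1 = 0 by rewrite (zr_nat R 0) mul0r.
have [C1 up] := star_upper (esym half) zr0 (zr_nat R 1) p_ge p_lt1 v0 (star_le star_certificate).
have al0 : 0 <= zr 1 / zr 2500 by apply: divr_ge0; exact: zr_ge0.
have al_lt : zr 1 / zr 2500 < zr 499 / zr 1000 by exact: zr_frac_lt.
have e_le : zr 499 / zr 1000 <= 2^-1 by rewrite half; exact: zr_frac_le.
have v_le : zr 742036 / zr 2053107 <= 2 / 5.
  by rewrite -(zr_nat R 2) -(zr_nat R 5); exact: zr_frac_le.
have p_le : p <= 3 / 4 by rewrite -(zr_nat R 3) -(zr_nat R 4); exact: zr_frac_le.
have al_le : zr 1 / zr 2500 <= 1 / 100.
  by rewrite -[1](zr_nat R 1) -(zr_nat R 100); exact: zr_frac_le.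
have e_ge : 49 / 100 <= zr 499 / zr 1000.
  by rewrite -(zr_nat R 49) -(zr_nat R 100); exact: zr_frac_le.
have [vp vd] := small_bounds v_le p_le al0 al_le e_ge.
have zrN1 : zr (-1) = -1 by rewrite (zrN R 1) (zr_nat R 1).
have [C2 lo] := dev_guarantee zrN1 p_ge p_lt1 al0 al_lt e_le vp vd (dev_ge dev_certificate).
apply: (not_optimal_of_better _ _ _ up lo).
- by rewrite (le_trans _ p_ge) ?invr_ge0 ?ler0n // ltW.
- exact: dev_strategyP.
- exact: zr_frac_lt.
Qed.

End Counterexample.

Theorem theorem1 (R : realType) :
  (forall p : R, 2^-1 <= p < 719 / 1000 -> is_optimal p (sigma_star p)) /\
  (exists p : R, 2^-1 <= p < 733 / 1000 /\ ~ is_optimal p (sigma_star p)).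
Proof.
split; last exact: sigma_star_not_optimal.
move=> p /andP[p_ge p_lt].
(* The contraction is available up to 18/25 = 0.72, slightly beyond the claimed range. *)
have p_le : p <= 18 / 25 by lra.
apply: sigma_star_optimal => //; first by lra.
have [h1|h1] := lerP p (6 / 10); first exact: level_small_low.
have [h2|h2] := lerP p (7 / 10); first by apply: level_small_mid => //; exact: ltW.
by apply: level_small_high => //; exact: ltW.
Qed.
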